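(* Let $0\leq\beta\leq 1$ and $0<k\leq 1$, let $N\geq 1$ be an integer, and let $\rho_{AB_{0}B_{1}\cdots B_{N-1}}$ be any $(N+1)$-partite quantum state (with subsystems of arbitrary finite dimensions). Suppose that the subsystems $B_0,B_1,\ldots,B_{N-1}$ satisfy $$E_{a}(\rho_{A|B_{0}})\geq\frac{1}{k}E_{a}(\rho_{A|B_{1}})\geq\frac{1}{k^{2}}E_{a}(\rho_{A|B_{2}})\geq\cdots\geq\frac{1}{k^{N-1}}E_{a}(\rho_{A|B_{N-1}})\geq 0 .$$ Then $$\left[E_{a}(\rho_{A|B_{0}B_{1}\cdots B_{N-1}})\right]^{\beta}\leq \sum_{j=0}^{N-1}\left[\frac{(1+k)^\beta-1}{k^\beta}\right]^{\omega_{H}(\vec{j})}\left[E_{a}(\rho_{A|B_{j}})\right]^{\beta},$$ where $E_a$ is the entanglement of assistance and $\omega_H(\vec j)$ is the Hamming weight of the binary vector of $j$.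
   Context: All Hilbert spaces are finite-dimensional (of arbitrary dimension); a quantum state is a density matrix (positive semidefinite, trace one). For a bipartite pure state $|\psi\rangle_{XY}$, the entropy of entanglement is $E(|\psi\rangle_{X|Y})=S(\rho_X)=-\mathrm{Tr}\,\rho_X\ln\rho_X$, where $\rho_X=\mathrm{Tr}_Y|\psi\rangle\langle\psi|$. For a bipartite state $\rho_{XY}$, the entanglement of assistance (EOA) is $$E_a(\rho_{X|Y})=\max\sum_i p_i\,E(|\psi_i\rangle_{X|Y}),$$ where the maximum is over all pure-state decompositions $\rho_{XY}=\sum_i p_i|\psi_i\rangle_{XY}\langle\psi_i|$ (with $p_i\geq 0$, $\sum_i p_i=1$, $|\psi_i\rangle$ unit vectors). For the multipartite state $\rho_{AB_0\cdots B_{N-1}}$, $E_a(\rho_{A|B_0B_1\cdots B_{N-1}})$ denotes the EOA of this state viewed as a bipartite state with respect to the partition into $A$ and $B_0B_1\cdots B_{N-1}$ (jointly), and $E_a(\rho_{A|B_j})$ denotes the EOA of the reduced density matrix $\rho_{AB_j}$ obtained by tracing out all $B_i$ with $i\neq j$. For a non-negative integer $j$ with binary expansion $j=\sum_{i=0}^{n-1}j_i2^i$, where $\log_2 j<n$ and $j_i\in\{0,1\}$, the binary vector of $j$ is $\vec j=(j_0,j_1,\ldots,j_{n-1})$, and its Hamming weight $\omega_H(\vec j)$ is the number of its coordinates equal to $1$ (so $\omega_H(\vec 0)=0$). The convention $0^0=1$ is used. *)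

(* Defs.v *)
From HB Require Import structures.
From mathcomp Require Import all_boot all_order all_algebra.
From mathcomp Require Import all_classical all_reals all_analysis.
From mathcomp Require Import complex.

Set Implicit Arguments.
Unset Strict Implicit.
Unset Printing Implicit Defensive.

Import Order.TTheory GRing.Theory Num.Theory.

Local Open Scope classical_set_scope.
Local Open Scope sesquilinear_scope.
Local Open Scope complex_scope.
Local Open Scope ring_scope.

(* A Hilbert space of dimension #|T| is presented by a finite type T labelling
   an orthonormal basis, so that X * Y labels the product basis of the tensor
   product.  Vectors and operators are matrices over R[i] whose ordinal indices
   are converted to labels by enum_val / enum_rank. *)
Section Operators.
Variable R : realType.

Definition ket (T : finType) : Type := 'cV[R[i]]_#|T|.
Definition op (T : finType) : Type := 'M[R[i]]_#|T|.

Definition op_of_fun (T : finType) (f : T -> T -> R[i]) : op T :=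
  \matrix_(i, j) f (enum_val i) (enum_val j).

Definition op_entry (T : finType) (rho : op T) (x y : T) : R[i] :=
  rho (enum_rank x) (enum_rank y).

(* In the order of R[i], 0 <= z says that z is real and nonnegative; hence the
   first clause forces rho to be Hermitian. *)
Definition density (T : finType) (rho : op T) : Prop :=
  (forall v : ket T, 0 <= (v^t* *m rho *m v) 0 0) /\ \tr rho = 1.

Definition unit_ket (T : finType) (psi : ket T) : Prop :=
  psi^t* *m psi = 1%:M.

Definition ketbra (T : finType) (psi : ket T) : op T := psi *m psi^t*.

Definition partial_trace_snd (X Y : finType) (rho : op (X * Y)%type) : op X :=
  op_of_fun (fun x x' => \sum_(y : Y) op_entry rho (x, y) (x', y)).

(* Functional calculus through spectral decomposition; only meaningful for
   Hermitian rho, whose eigenvalues are real. *)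
Definition op_fun (f : R -> R) (T : finType) (rho : op T) : op T :=
  invmx (spectralmx rho)
    *m diag_mx (map_mx (fun z : R[i] => (f (complex.Re z))%:C) (spectral_diag rho))
    *m spectralmx rho.

(* - Tr (rho ln rho).  Since the library's ln is total, a zero eigenvalue
   contributes 0 * ln 0 = 0, as usual.  Re only changes the type: the trace is
   real when rho is Hermitian. *)
Definition entropy (T : finType) (rho : op T) : R :=
  - complex.Re (\tr (rho *m op_fun (@ln R) rho)).

Definition entanglement_entropy (X Y : finType) (psi : ket (X * Y)%type) : R :=
  entropy (partial_trace_snd (ketbra psi)).

Definition pure_decomposition (T : finType) (rho : op T)
    (m : nat) (p : 'I_m -> R) (psi : 'I_m -> ket T) : Prop :=
  [/\ forall i, 0 <= p i,
      \sum_(i < m) p i = 1,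
      forall i, unit_ket (psi i) &
      rho = \sum_(i < m) (p i)%:C *: ketbra (psi i)].

(* Entanglement of assistance.  The supremum is taken in R; for a density
   operator the set is nonempty, bounded above by ln #|X|, and by compactness
   the supremum is a maximum. *)
Definition EOA (X Y : finType) (rho : op (X * Y)%type) : R :=
  sup [set e | exists (m : nat) (p : 'I_m -> R) (psi : 'I_m -> ket (X * Y)%type),
         pure_decomposition rho p psi /\
         e = \sum_(i < m) p i * entanglement_entropy (psi i)].

(* Labels of the joint system B_0 ... B_(N-1) are the dependent functions
   choosing one label of each B_i.  The reduced operator on A B_j traces out
   every B_i with i != j. *)
Definition reduced_AB (A : finType) (N : nat) (B : 'I_N -> finType)
    (rho : op (A * {dffun forall i : 'I_N, B i})%type) (j : 'I_N) :
    op (A * B j)%type :=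
  op_of_fun (fun x y : A * B j =>
    \sum_(f : {dffun forall i : 'I_N, B i} | f j == x.2)
      \sum_(g : {dffun forall i : 'I_N, B i} |
             (g j == y.2) && [forall (i | i != j), g i == f i])
        op_entry rho (x.1, f) (y.1, g)).

End Operators.

Definition binary_vector (n j : nat) : n.-tuple bool :=
  [tuple odd (j %/ 2 ^ i) | i < n].

(* Uses the least positive number n of digits with j < 2 ^ n; any larger n gives
   the same weight (hamming_weightE). *)
Definition hamming_weight (j : nat) : nat :=
  count_mem true (binary_vector (trunc_log 2 j).+1 j).

Lemma hamming_weightE (n j : nat) : (j < 2 ^ n)%N ->
  count_mem true (binary_vector n j) = hamming_weight j.
Proof.
have cE m : count_mem true (binary_vector m j) =
    (\sum_(0 <= i < m) odd (j %/ 2 ^ i))%N.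
  rewrite -sum1_count big_mkord big_tuple big_mkcond /=.
  by apply: eq_bigr => i _; rewrite tnth_mktuple; case: (odd _).
have stab m m' : (m <= m')%N -> (j < 2 ^ m)%N ->
    (\sum_(0 <= i < m') odd (j %/ 2 ^ i) = \sum_(0 <= i < m) odd (j %/ 2 ^ i))%N.
  move=> mm' jm; rewrite (big_cat_nat (leq0n m) mm') //= [X in (_ + X)%N]big_nat.
  rewrite [X in (_ + X)%N]big1 ?addn0 // => i /andP[mi _]; rewrite divn_small //.
  by apply: leq_trans jm _; rewrite leq_exp2l.
move=> jn; rewrite /hamming_weight !cE.
have jt := trunc_log_ltn j (isT : (1 < 2)%N).
have [le|/ltnW le] := leqP n (trunc_log 2 j).+1; last exact: stab.
by rewrite [RHS](stab n).
Qed.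

(* Main.v *)
(* Polygamy of assistance.  Let rho on X Y have eigenvectors e_k and eigenvalues
   l_k.  Besides the spectral decomposition, rho is the average over all signs
   s_k of the pure states f_s = sum_k s_k sqrt(l_k) e_k.  The two ensembles come
   from measuring a purifying register K in its eigenbasis and in the sign
   vectors.  Monotonicity of the relative entropy between the state of X K and
   its dephasing in the eigenbasis, under the sign measurement, reads
     S(X) + S(Y) <= sum_k l_k S(e_k) + S(X Y) + average_s S(f_s),
   so one of the two decompositions gives E_a >= (S(X) + S(Y) - S(X Y)) / 2.
   For a pure state on A B K the two halves I(A:B) / 2 and I(A:K) / 2 add up to
   S(A).  As E_a is concave, this extends to mixed states, and induction on the
   number of parties gives E_a(A|B_0 ... B_(N-1)) <= sum_j E_a(A|B_j).

   Monotonicity itself: up to normalisation the relative entropy is an integral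
   over t > 0 of the maximum over matrices B of
   2 Re tr(rho B) - tr(B' sigma B) - t tr(B rho B'), with ' the adjoint, and
   optimal B_e for the measured states K_e rho K_e' combine into the candidate
   sum_e K_e' B_e K_e for rho.

   Powers.  Concavity of t^beta gives (x + y)^beta <= x^beta + c y^beta whenever
   y <= k x, where c = ((1 + k)^beta - 1) / k^beta.  Splitting the sum at the
   highest power of two below N turns each leading binary digit into a factor c. *)
Require Import Defs.
From HB Require Import structures.
From mathcomp Require Import all_boot all_order all_algebra.
From mathcomp Require Import all_classical all_reals all_analysis.
From mathcomp Require Import complex ring lra.

Set Implicit Arguments.
Unset Strict Implicit.
Unset Printing Implicit Defensive.

Import Order.TTheory GRing.Theory Num.Theory.
Import numFieldNormedType.Exports.

Local Open Scope sesquilinear_scope.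
Local Open Scope complex_scope.
Local Open Scope ring_scope.

(** * Traces and functional calculus *)

(* Locked, since a failed unification would otherwise unfold traces and matrix
   products down to sums of entries. *)
HB.lock Definition retr (R : realType) n (M : 'M[R[i]]_n) : R := complex.Re (\tr M).
Canonical retr_unlockable := Unlockable retr.unlock.
Arguments retr {R n} M.

HB.lock Definition mxfun (R : realType) (f : R -> R) n (M : 'M[R[i]]_n) : 'M[R[i]]_n :=
  invmx (spectralmx M)
    *m diag_mx (map_mx (fun z : R[i] => (f (complex.Re z))%:C) (spectral_diag M))
    *m spectralmx M.
Canonical mxfun_unlockable := Unlockable mxfun.unlock.
Arguments mxfun {R} f {n} M.

(** * Adjoints and real traces *)

Section Adjoint.
Variable R : realType.
Local Notation C := R[i].

Lemma adjmxM m n p (M : 'M[C]_(m, n)) (N : 'M[C]_(n, p)) :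
  (M *m N)^t* = N^t* *m M^t*.
Proof. by rewrite trmx_mul map_mxM. Qed.

Lemma adjmxD m n (M N : 'M[C]_(m, n)) : (M + N)^t* = M^t* + N^t*.
Proof. by rewrite linearD map_mxD. Qed.

Lemma adjmxB m n (M N : 'M[C]_(m, n)) : (M - N)^t* = M^t* - N^t*.
Proof. by rewrite linearB map_mxB. Qed.

Lemma adjmx_sum (I : Type) (s : seq I) (P : pred I) m n (F : I -> 'M[C]_(m, n)) :
  (\sum_(i <- s | P i) F i)^t* = \sum_(i <- s | P i) (F i)^t*.
Proof. by rewrite linear_sum map_mx_sum. Qed.

Lemma conjCE (z : C) : Num.conj z = conjc z. Proof. by []. Qed.

Lemma adjmxZ m n (a : R) (M : 'M[C]_(m, n)) : (a%:C *: M)^t* = a%:C *: M^t*.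
Proof. by rewrite linearZ map_mxZ /= conjCE conjc_real. Qed.

Lemma adjmx1 n : (1%:M : 'M[C]_n)^t* = 1%:M.
Proof. by rewrite trmx1 map_mx1. Qed.

Lemma Re_sum (I : Type) (s : seq I) (P : pred I) (F : I -> C) :
  complex.Re (\sum_(i <- s | P i) F i) = \sum_(i <- s | P i) complex.Re (F i).
Proof. exact: (raddf_sum (@complex.Re R : Rcomplex R -> R)). Qed.

Lemma ReZ (a : R) (z : C) : complex.Re (a%:C * z) = a * complex.Re z.
Proof. by case: z => x y /=; rewrite mul0r subr0. Qed.

Lemma retrZ n (a : R) (M : 'M[C]_n) : retr (a%:C *: M) = a * retr M.
Proof. by rewrite unlock mxtraceZ ReZ. Qed.

Lemma retr_sum (I : Type) (s : seq I) (P : pred I) n (F : I -> 'M[C]_n) :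
  retr (\sum_(i <- s | P i) F i) = \sum_(i <- s | P i) retr (F i).
Proof. by rewrite unlock -Re_sum; congr (complex.Re _); rewrite raddf_sum. Qed.

Lemma retrC m n (M : 'M[C]_(m, n)) (N : 'M[C]_(n, m)) :
  retr (M *m N) = retr (N *m M).
Proof. by rewrite unlock mxtrace_mulC. Qed.

Lemma retr_adj n (M : 'M[C]_n) : retr (M^t*) = retr M.
Proof.
rewrite unlock /mxtrace !Re_sum; apply: eq_bigr => i _.
by rewrite !mxE; case: (M i i).
Qed.

Definition sqmod (z : C) : R := complex.Re z ^+ 2 + complex.Im z ^+ 2.

Lemma sqmodE z : z * conjc z = (sqmod z)%:C.
Proof. by case: z => x y; rewrite /sqmod /=; congr (_ +i* _); ring. Qed.

Lemma sqmodE' z : conjc z * z = (sqmod z)%:C.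
Proof. by rewrite mulrC sqmodE. Qed.

Lemma sqmod_ge0 z : 0 <= sqmod z.
Proof. by rewrite addr_ge0 ?sqr_ge0. Qed.

Lemma sqmod_eq0 z : (sqmod z == 0) = (z == 0).
Proof.
by case: z => x y; rewrite /sqmod eq_complex /= paddr_eq0 ?sqr_ge0 // !sqrf_eq0.
Qed.

Lemma mulmx_adjE m n (M : 'M[C]_(m, n)) i :
  (M *m M^t*) i i = (\sum_j sqmod (M i j))%:C.
Proof.
rewrite !mxE raddf_sum; apply: eq_bigr => j _.
by rewrite !mxE /= -sqmodE.
Qed.

Lemma adj_mulmxE m n (M : 'M[C]_(m, n)) j :
  (M^t* *m M) j j = (\sum_i sqmod (M i j))%:C.
Proof.
rewrite !mxE raddf_sum; apply: eq_bigr => i _.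
by rewrite !mxE /= -sqmodE'.
Qed.

End Adjoint.

(** * Functional calculus of Hermitian matrices and von Neumann entropy *)

Section FunctionalCalculus.
Variable R : realType.
Local Notation C := R[i].

Definition unitary n (U : 'M[C]_n) := U *m U^t* = 1%:M /\ U^t* *m U = 1%:M.

Definition rdiag n (r : 'rV[R]_n) : 'M[C]_n := diag_mx (map_mx (real_complex R) r).

Lemma rdiagE n (r : 'rV[R]_n) i j : rdiag r i j = (r 0 i)%:C *+ (i == j).
Proof. by rewrite !mxE. Qed.

Lemma adj_rdiag n (r : 'rV[R]_n) : (rdiag r)^t* = rdiag r.
Proof.
apply/matrixP => i j; rewrite !mxE eq_sym raddfMn /= conjCE conjc_real.
by case: eqP => [->|].
Qed.

Lemma rdiagM n (r s : 'rV[R]_n) :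
  rdiag r *m rdiag s = rdiag (\row_i (r 0 i * s 0 i)).
Proof.
rewrite /rdiag mulmx_diag; congr diag_mx; apply/rowP => i.
by rewrite !mxE rmorphM.
Qed.

Lemma retr_rdiag n (r : 'rV[R]_n) : retr (rdiag r) = \sum_i r 0 i.
Proof.
rewrite unlock /mxtrace Re_sum; apply: eq_bigr => i _.
by rewrite rdiagE eqxx mulr1n.
Qed.

Definition eigenval n (M : 'M[C]_n) : 'rV[R]_n :=
  map_mx (@complex.Re R) (spectral_diag M).

Lemma spectral_unitary n (M : 'M[C]_n) : unitary (spectralmx M).
Proof.
have U := spectral_unitarymx M; split; first exact/unitarymxP.
by rewrite -invmx_unitary // mulVmx // spectral_unit.
Qed.

Lemma mxfunE f n (M : 'M[C]_n) :
  mxfun f M = (spectralmx M)^t* *m rdiag (map_mx f (eigenval M)) *m spectralmx M.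
Proof.
rewrite unlock (invmx_unitary (spectral_unitarymx M)) /rdiag /eigenval.
by rewrite -!map_mx_comp.
Qed.

Lemma spectralE n (M : 'M[C]_n) : M^t* = M ->
  M = (spectralmx M)^t* *m rdiag (eigenval M) *m spectralmx M.
Proof.
move=> hM; have hh : M \is hermsymmx.
  by apply/is_hermitianmxP; rewrite expr0 scale1r; exact/esym.
have := hermitian_normalmx hh => /orthomx_spectralP {1}->.
rewrite (invmx_unitary (spectral_unitarymx M)).
suff -> : rdiag (eigenval M) = diag_mx (spectral_diag M) by [].
congr diag_mx; apply/rowP => i; rewrite !mxE.
have /mxOverP/(_ 0 i) := hermitian_spectral_diag_real hh.
by case/complex_realP => x ->.
Qed.

(** In the two eigenbases [W] becomes [X], which intertwines the diagonal matrices: an entry [X j i]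
    can be nonzero only where [s j = r i], and there [f] takes equal values. Hence [f] may be any
    function. *)
Lemma diag_intertwine f m n (V : 'M[C]_m) (U : 'M[C]_n) s r (W : 'M[C]_(m, n)) :
    unitary V -> unitary U ->
    V^t* *m rdiag s *m V *m W = W *m (U^t* *m rdiag r *m U) ->
  V^t* *m rdiag (map_mx f s) *m V *m W = W *m (U^t* *m rdiag (map_mx f r) *m U).
Proof.
move=> [V1 V2] [U1 U2] h; pose X := V *m W *m U^t*.
have hX : rdiag s *m X = X *m rdiag r.
  move: (congr1 (fun Y => V *m Y *m U^t*) h); rewrite /X !mulmxA V1 mul1mx => ->.
  by rewrite -mulmxA U1 mulmx1.
suff hf : rdiag (map_mx f s) *m X = X *m rdiag (map_mx f r).
  have VW : V *m W = X *m U by rewrite /X -!mulmxA U2 mulmx1.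
  have WU : W *m U^t* = V^t* *m X by rewrite /X !mulmxA V2 mul1mx.
  by rewrite -!mulmxA VW (mulmxA W) WU (mulmxA _ X) hf !mulmxA.
apply/matrixP => j i; move/matrixP/(_ j i): hX.
rewrite /rdiag !mul_diag_mx !mul_mx_diag !mxE => /eqP.
rewrite mulrC -subr_eq0 -mulrBr mulf_eq0 subr_eq0 => /orP[/eqP->|].
  by rewrite mulr0 mul0r.
by rewrite mulrC => /eqP/complexI ->.
Qed.

Lemma mxfun_intertwine f m n (K : 'M[C]_m) (H : 'M[C]_n) (W : 'M[C]_(m, n)) :
  K^t* = K -> H^t* = H -> K *m W = W *m H -> mxfun f K *m W = W *m mxfun f H.
Proof.
move=> /spectralE hK /spectralE hH; rewrite {1}hK {1}hH !mxfunE.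
by apply: diag_intertwine; exact: spectral_unitary.
Qed.

(** Independence of the chosen diagonalisation: the intertwining property is applied with the
    identity as intertwiner. *)
Lemma mxfun_diag f n (U : 'M[C]_n) r : unitary U ->
  mxfun f (U^t* *m rdiag r *m U) = U^t* *m rdiag (map_mx f r) *m U.
Proof.
move=> hU; set M := _ *m U.
have hM : M^t* = M by rewrite /M !adjmxM adj_rdiag trmxCK mulmxA.
rewrite -[RHS]mul1mx -[LHS]mulmx1 mxfunE.
have := spectral_unitary M; have := spectralE hM.
move: (spectralmx M) (eigenval M) => V s hV uV.
by apply: (diag_intertwine _ uV hU); rewrite -hV -/M mulmx1 mul1mx.
Qed.

Lemma adj_mxfun f n (M : 'M[C]_n) : (mxfun f M)^t* = mxfun f M.
Proof. by rewrite mxfunE !adjmxM adj_rdiag trmxCK mulmxA. Qed.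

Lemma mxfun1 f n : mxfun f (1%:M : 'M[C]_n) = (f 1)%:C%:M.
Proof.
have u1 : unitary (1%:M : 'M[C]_n) by split; rewrite ?adjmx1 ?mulmx1.
have e c : c%:C%:M = (1%:M : 'M[C]_n)^t* *m rdiag (const_mx c) *m 1%:M.
  by rewrite mulmx1 adjmx1 mul1mx /rdiag map_const_mx diag_const_mx.
by rewrite [in LHS](e 1) mxfun_diag // map_const_mx -e.
Qed.

(** The trace of [M] is left free, so that the unnormalised members of an ensemble have an entropy
    too. *)
Definition vnent n (M : 'M[C]_n) : R := - retr (M *m mxfun (@ln R) M).

Lemma retr_conj n (U : 'M[C]_n) r : unitary U -> 
  retr (U^t* *m rdiag r *m U) = \sum_i r 0 i.
Proof. by case=> U1 U2; rewrite retrC mulmxA U1 mul1mx retr_rdiag. Qed.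

Lemma vnent_diag n (U : 'M[C]_n) r : unitary U ->
  vnent (U^t* *m rdiag r *m U) = - \sum_i r 0 i * ln (r 0 i).
Proof.
move=> hU; rewrite /vnent mxfun_diag //; congr (- _).
have [U1 U2] := hU; rewrite -!mulmxA (mulmxA U) U1 mul1mx (mulmxA (rdiag _)) rdiagM.
by rewrite mulmxA retr_conj //; apply: eq_bigr => i _; rewrite !mxE.
Qed.

Lemma vnentE n (M : 'M[C]_n) : M^t* = M ->
  vnent M = - \sum_i eigenval M 0 i * ln (eigenval M 0 i).
Proof. by move=> hM; rewrite {1}(spectralE hM) vnent_diag //; exact: spectral_unitary. Qed.

Lemma adj_gram m n (W : 'M[C]_(m, n)) : (W *m W^t*)^t* = W *m W^t*.
Proof. by rewrite adjmxM trmxCK. Qed.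

(** [W] intertwines the two Gram matrices, hence also their logarithms, and the trace is cyclic. For
    a pure state this is the equality of the entropies of the two marginals. *)
Lemma vnent_gramC m n (W : 'M[C]_(m, n)) : vnent (W *m W^t*) = vnent (W^t* *m W).
Proof.
rewrite /vnent; congr (- _).
have hW : mxfun (@ln R) (W *m W^t*) *m W = W *m mxfun (@ln R) (W^t* *m W).
  apply: mxfun_intertwine; rewrite ?adj_gram ?mulmxA //.
  by rewrite -{2}[W]trmxCK adj_gram trmxCK.
by rewrite -mulmxA retrC -mulmxA hW mulmxA.
Qed.

End FunctionalCalculus.
(** * Monotonicity of relative entropy *)

Section LogIntegral.
Variable R : realType.

Lemma is_derive_ln_affine (a s r t : R) : 0 < s + t * r ->
  is_derive t (1 : R) (fun t => a * ln (s + t * r)) (a * (r / (s + t * r))).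
Proof.
move=> h.
have d1 : is_derive t (1 : R) (fun t : R => s + t * r) r.
  apply: is_derive_eq. by rewrite scaler0 !add0r mul1r -[_ *: _]/(r * _) mulr1.
have d2 := @is_derive1_comp R (@ln R) (fun t => s + t * r) t _ _ (is_derive1_ln h) d1.
apply: (is_derive_eq (is_deriveZ a d2)).
by rewrite -[LHS]/(a * _) [X in a * X]mulrC.
Qed.

Lemma is_derive_fsum (I : finType) (F : I -> R -> R) (D : I -> R) (t : R) :
  (forall i, is_derive t (1 : R) (F i) (D i)) ->
  is_derive t (1 : R) (fun t => \sum_i F i t) (\sum_i D i).
Proof.
move=> h; have -> : (fun t => \sum_i F i t) = \sum_i F i.
  by apply/funext => x; rewrite fct_sumE.
elim/big_ind2: _ => // [|f x g y hf hg]; first exact: is_derive_cst.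
exact: is_deriveD.
Qed.

Lemma cvg_fsum (T : Type) (F : set_system T) (FF : Filter F) (I : finType)
    (f : I -> T -> R) (l : I -> R) :
  (forall i, f i x @[x --> F] --> l i)%classic ->
  (\sum_i f i x @[x --> F] --> \sum_i l i)%classic.
Proof.
move=> h; have -> : (fun x => \sum_i f i x) = \sum_i f i.
  by apply/funext => x; rewrite fct_sumE.
elim/big_ind2: _ => // [|u x v y hu hv]; first exact: cvg_cst.
exact: cvgD.
Qed.

(* [ln r - ln s] is the integral of [r / (s + t r) - 1 / (1 + t)] over [t > 0]. *)
Lemma sum_ln_ge0 (I : finType) (a r s : I -> R) :
    (forall i, a i != 0 -> 0 < r i /\ 0 < s i) ->
    \sum_i a i = 0 ->
    (forall t : R, 0 < t -> 0 <= \sum_i a i * (r i / (s i + t * r i))) ->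
  0 <= \sum_i a i * (ln (r i) - ln (s i)).
Proof.
move=> rs_gt0 suma hge0.
pose F i (t : R) := a i * ln (s i + t * r i).
pose S t := \sum_i F i t.
have dF i (t : R) : 0 < t -> is_derive t (1 : R) (F i) (a i * (r i / (s i + t * r i))).
  move=> t0; have [ai0|/rs_gt0[r0 s0]] := eqVneq (a i) 0.
    have -> : F i = cst 0 by apply/funext => x; rewrite /F ai0 mul0r.
    by rewrite ai0 mul0r; exact: is_derive_cst.
  by apply: is_derive_ln_affine; rewrite addr_gt0 // mulr_gt0.
have dS (t : R) : 0 < t -> is_derive t (1 : R) S (\sum_i a i * (r i / (s i + t * r i))).
  by move=> t0; apply: is_derive_fsum => i; exact: dF.
have S_nd (x y : R) : 0 < x -> x <= y -> S x <= S y.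
  move=> x0 xy; apply: (@ger0_derive1_ndecr R S x y) => //.
  - move=> z; rewrite in_itv /= => /andP[xz _]; have z0 := lt_trans x0 xz.
    by have [] := dS z z0.
  - move=> z; rewrite in_itv /= => /andP[xz _]; have z0 := lt_trans x0 xz.
    by rewrite derive1E (@derive_val _ _ _ _ _ _ _ (dS z z0)) hge0.
  - apply: derivable_within_continuous => z; rewrite in_itv /= => /andP[xz _].
    by have [] := dS z (lt_le_trans x0 xz).
(* [S] is an antiderivative of the integrand. Up to [ln e] times the vanishing sum of the [a i],
   [G e] is [S e^-1 - S e], and it tends to the claimed sum as [e] tends to 0. *)
pose G (e : R) := \sum_i a i * (ln (r i + e * s i) - ln (s i + e * r i)).
have G_ge0 (e : R) : 0 < e -> e < 1 -> 0 <= G e.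
  move=> e0 e1; have -> : G e = S e^-1 - S e.
    have -> : G e = G e + (\sum_i a i) * - ln e by rewrite suma mul0r addr0.
    rewrite /S /G /F mulr_suml -!sumrB -big_split /=; apply: eq_bigr => i _.
    have [->|/rs_gt0[r0 s0]] := eqVneq (a i) 0; first by ring.
    have -> : r i + e * s i = e * (s i + e^-1 * r i) by field; lra.
    rewrite lnM ?posrE // ?addr_gt0 ?mulr_gt0 ?invr_gt0 //; ring.
  by rewrite subr_ge0; apply: S_nd => //; rewrite (le_trans (ltW e1)) // invf_ge1 // ltW.
have cG : (G e @[e --> (0 : R)^'+] --> \sum_i a i * (ln (r i) - ln (s i)))%classic.
  rewrite /G; apply: cvg_fsum => i.
  have [->|/rs_gt0[r0 s0]] := eqVneq (a i) 0.
    by under eq_fun do rewrite mul0r; rewrite mul0r; exact: cvg_cst.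
  have c (x y : R) : 0 < x -> (ln (x + e * y) @[e --> (0 : R)^'+] --> ln x)%classic.
    move=> x0; apply: cvg_at_right_filter.
    have h : (x + e * y @[e --> (0 : R)] --> x)%classic.
      rewrite -[X in (_ --> X)%classic]addr0 -[X in _ + X](mul0r y).
      by apply: cvgD; [exact: cvg_cst|apply: cvgMl; exact: cvg_id].
    exact: (continuous_cvg _ (continuous_ln x0) h).
  by apply: cvgMr; apply: cvgB; exact: c.
apply: (cvgr_to_ge cG); near=> e; apply: G_ge0.
- by near: e; exact: nbhs_right_gt.
- by near: e; exact: nbhs_right_lt.
Unshelve. all: by end_near.
Qed.

(** The left side is a concave quadratic in the complex number with parts [x1], [x2], maximal at
    [(r / d)] times the one with parts [p1], [p2]. For [d = 0] the quotient is 0 by convention and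
    [r = 0] makes the left side vanish as well. *)
Lemma complete_square (d r p1 p2 x1 x2 : R) : 0 <= d -> (d = 0 -> r = 0) ->
  2 * (r * (p1 * x1 + p2 * x2)) - d * (x1 ^+ 2 + x2 ^+ 2)
    <= (p1 ^+ 2 + p2 ^+ 2) * (r ^+ 2 / d).
Proof.
rewrite le_eqVlt => /predU1P[<- /(_ erefl) ->|d0 _].
  by rewrite !mul0r mulr0 subrr expr0n /= mul0r mulr0.
rewrite -subr_ge0 [leRHS](_ : _ =
    ((d * x1 - r * p1) ^+ 2 + (d * x2 - r * p2) ^+ 2) / d); last by field; lra.
by rewrite divr_ge0 ?addr_ge0 ?sqr_ge0 // ltW.
Qed.

End LogIntegral.

(** * Matrix identities over a commutative ring, with primed letters standing for adjoints *)

Section MatrixAlgebra.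
Variable S : comPzRingType.

Lemma mulmx_addZ m (x' y' : 'M[S]_(1, m)) (x y : 'M[S]_(m, 1)) (M : 'M[S]_m) c' c :
  ((x' + c' *: y') *m M *m (x + c *: y)) 0 0 =
  (x' *m M *m x) 0 0 + c * (x' *m M *m y) 0 0
  + (c' * (y' *m M *m x) 0 0 + c' * (c * (y' *m M *m y) 0 0)).
Proof.
have addE (X Y : 'M[S]_1) : (X + Y) 0 0 = X 0 0 + Y 0 0 by rewrite mxE.
have scaleE a (X : 'M[S]_1) : (a *: X) 0 0 = a * X 0 0 by rewrite mxE.
by rewrite !mulmxDl !mulmxDr -!scalemxAl -!scalemxAr !addE !scaleE.
Qed.

Lemma mulmx_entry m n p (M : 'M[S]_(m, n)) (N : 'M[S]_(n, p)) i k :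
  (M *m N) i k = \sum_j M i j * N j k.
Proof. by rewrite mxE. Qed.

Lemma mxtrace_subB m n (Y' : 'M[S]_(m, n)) (Y : 'M[S]_(n, m)) (M B' B : 'M[S]_n)
    (K : 'M[S]_(m, n)) (K' : 'M[S]_(n, m)) :
  \tr ((Y' - K *m B') *m M *m (Y - B *m K')) =
  \tr (Y' *m M *m Y) - \tr (Y' *m M *m (B *m K')) - \tr (B' *m M *m (Y *m K))
  + \tr (B' *m M *m B *m (K' *m K)).
Proof.
have e (X : 'M[S]_(n, m)) : \tr (K *m B' *m M *m X) = \tr (B' *m M *m (X *m K)).
  by rewrite -!mulmxA mxtrace_mulC !mulmxA.
rewrite !mulmxBl !mulmxBr !(raddfB (@mxtrace S m)) /= !e !mulmxA.
by rewrite opprB addrA addrAC.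
Qed.

Lemma mulmx_sandwich m n (U U' : 'M[S]_m) (V V' s : 'M[S]_n)
    (X : 'M[S]_(n, m)) (X' : 'M[S]_(m, n)) : V *m V' = 1%:M ->
  (U' *m (X' *m V)) *m (V' *m s *m V) *m (V' *m X *m U) = U' *m (X' *m (s *m X)) *m U.
Proof.
move=> h; have VK p (M : 'M[S]_(p, n)) : M *m V *m V' = M by rewrite -mulmxA h mulmx1.
by rewrite !mulmxA !VK.
Qed.

Lemma mulmx_conjugate n (V V' U U' r g : 'M[S]_n) : V' *m V = 1%:M ->
  (U' *m r *m U) *m (V' *m g *m V) = V' *m (V *m U' *m r *m (U *m V') *m g) *m V.
Proof. by move=> h; rewrite !mulmxA h mul1mx. Qed.

End MatrixAlgebra.

Lemma adjmx_entry (R : realType) m n (M : 'M[R[i]]_(m, n)) i j :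
  (M^t*) i j = conjc (M j i).
Proof. by rewrite !mxE. Qed.

Lemma map_mxE (S T : Type) (f : S -> T) m n (M : 'M[S]_(m, n)) i j :
  map_mx f M i j = f (M i j).
Proof. by rewrite mxE. Qed.


(** * Variational form of the integrand, and monotonicity under measurement *)

Section Monotonicity.
Variable R : realType.
Local Notation C := R[i].

Definition psd n (M : 'M[C]_n) : Prop :=
  forall v : 'cV[C]_n, 0 <= (v^t* *m M *m v) 0 0.

Lemma psd_gram m n (W : 'M[C]_(m, n)) : psd (W *m W^t*).
Proof.
move=> v; rewrite !mulmxA -mulmxA -{2}[v]trmxCK -adjmxM mulmx_adjE ler0c.
by apply: sumr_ge0 => j _; exact: sqmod_ge0.
Qed.

Lemma psd_conj m n (K : 'M[C]_(m, n)) (M : 'M[C]_n) :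
  psd M -> psd (K *m M *m K^t*).
Proof.
move=> h v; have := h (K^t* *m v).
by rewrite adjmxM trmxCK !mulmxA.
Qed.

Lemma psd_sum (I : finType) n (q : I -> R) (M : I -> 'M[C]_n) :
  (forall i, 0 <= q i) -> (forall i, psd (M i)) ->
  psd (\sum_i (q i)%:C *: M i).
Proof.
move=> q0 h v; rewrite mulmx_sumr mulmx_suml summxE; apply: sumr_ge0 => i _.
by rewrite -scalemxAr -scalemxAl mxE mulr_ge0 ?h // ler0c.
Qed.

Lemma psd_retr m n (Y : 'M[C]_(n, m)) (M : 'M[C]_n) :
  psd M -> 0 <= retr (Y^t* *m M *m Y).
Proof.
move=> h; rewrite unlock /mxtrace Re_sum; apply: sumr_ge0 => i _.
have -> : (Y^t* *m M *m Y) i i = ((col i Y)^t* *m M *m col i Y) 0 0.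
  rewrite !mulmx_entry; apply: eq_bigr => j _; rewrite !mulmx_entry !mxE; congr (_ * _).
  by apply: eq_bigr => l _; rewrite !adjmx_entry mxE.
by have := h (col i Y); rewrite lecE /= => /andP[].
Qed.

(* Polarisation: a form that is real on the diagonal is Hermitian. *)
Lemma psd_herm n (M : 'M[C]_n) : psd M -> M^t* = M.
Proof.
move=> h; apply/matrixP => i j; rewrite adjmx_entry.
pose q (v : 'cV[C]_n) := (v^t* *m M *m v) 0 0.
have qr v : complex.Im (q v) = 0 by apply/eqP; have := h v; rewrite lecE => /andP[].
pose e k : 'cV[C]_n := delta_mx k 0.
have qe k l : ((e k)^t* *m M *m e l) 0 0 = M k l.
  rewrite mulmx_entry (bigD1 l) //= big1 ?addr0 => [|a al]; last first.
    by rewrite /e [X in _ * X]mxE (negbTE al) mulr0.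
  rewrite /e [X in _ * X]mxE !eqxx mulr1 mulmx_entry (bigD1 k) //= big1 ?addr0 => [|a ak]; last first.
    by rewrite adjmx_entry mxE (negbTE ak) conjc0 mul0r.
  by rewrite adjmx_entry mxE !eqxx conjc1 mul1r.
have qD c : q (e i + c *: e j) = M i i + c * M i j + (conjc c * M j i + conjc c * (c * M j j)).
  rewrite /q (_ : (e i + c *: e j)^t* = (e i)^t* + conjc c *: (e j)^t*); last first.
    by rewrite adjmxD; congr (_ + _); rewrite linearZ map_mxZ.
  rewrite mulmx_addZ.
  by congr (_ + _ * _ + (_ * _ + _ * (_ * _))); exact: qe.
have h1 := qr (e i + 1 *: e j); have h2 := qr (e i + 'i *: e j).
have hi : complex.Im (M i i) = 0 by rewrite -qe; exact: qr.
have hj : complex.Im (M j j) = 0 by rewrite -qe; exact: qr.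
move: h1 h2; rewrite !qD; move: hi hj.
case: (M i i) (M j j) (M i j) (M j i) => [a1 a2] [b1 b2] [c1 c2] [d1 d2] /= -> ->.
move=> h1 h2; congr (_ +i* _); lra.
Qed.

Lemma spectral_psd n (M : 'M[C]_n) : psd M ->
  M = (spectralmx M)^t* *m rdiag (eigenval M) *m spectralmx M.
Proof. by move/psd_herm/spectralE. Qed.

Lemma mulmx_rowE n (V M : 'M[C]_n) j :
  (((row j V)^t*)^t* *m M *m (row j V)^t*) 0 0 = (V *m M *m V^t*) j j.
Proof.
rewrite trmxCK -row_mul !mulmx_entry; apply: eq_bigr => k _.
by rewrite !adjmx_entry !mxE.
Qed.

Lemma psd_eigenval n (M : 'M[C]_n) i : psd M -> 0 <= eigenval M 0 i.
Proof.
move=> h; have [U1 U2] := spectral_unitary M.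
have := h ((row i (spectralmx M))^t*).
rewrite mulmx_rowE {2}(spectral_psd h) !mulmxA U1 mul1mx -mulmxA U1 mulmx1.
by rewrite rdiagE eqxx mulr1n ler0c.
Qed.

Lemma retr_unitary n (U M : 'M[C]_n) : unitary U -> retr (U^t* *m M *m U) = retr M.
Proof. by case=> U1 _; rewrite retrC mulmxA U1 mul1mx. Qed.

Lemma retr_rdiag_mul n (r : 'rV[R]_n) (M : 'M[C]_n) :
  retr (rdiag r *m M) = \sum_i r 0 i * complex.Re (M i i).
Proof.
rewrite unlock /mxtrace Re_sum; apply: eq_bigr => i _.
by rewrite /rdiag mul_diag_mx mxE map_mxE ReZ.
Qed.

Lemma Re_conjM (x y : C) : complex.Re (conjc x * y) =
  complex.Re x * complex.Re y + complex.Im x * complex.Im y.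
Proof. by case: x y => [a b] [c d] /=; ring. Qed.

(** For positive semidefinite [M] and [N] this is concave in [B], and its maximum is the integrand
    at [t] in the integral for the relative entropy, up to normalisation. *)
Definition quadratic n (M N : 'M[C]_n) (t : R) (B : 'M[C]_n) : R :=
  2 * retr (M *m B) - retr (B^t* *m N *m B) - t * retr (B *m M *m B^t*).

(** The Umegaki relative entropy. As [ln 0] is 0, it has its usual meaning only when the kernel of
    [N] lies in that of [M], which [relent_mono] assumes. *)
Definition relent n (M N : 'M[C]_n) : R :=
  retr (M *m mxfun (@ln R) M) - retr (M *m mxfun (@ln R) N).

Lemma retr_subB m n (Y' : 'M[C]_(m, n)) (Y : 'M[C]_(n, m)) (M B' B : 'M[C]_n)
    (K : 'M[C]_(m, n)) (K' : 'M[C]_(n, m)) :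
  retr ((Y' - K *m B') *m M *m (Y - B *m K')) =
  retr (Y' *m M *m Y) - retr (Y' *m M *m (B *m K')) - retr (B' *m M *m (Y *m K))
  + retr (B' *m M *m B *m (K' *m K)).
Proof.
rewrite unlock mxtrace_subB.
by move: (\tr _) (\tr _) (\tr _) (\tr _) => [a1 a2] [b1 b2] [c1 c2] [d1 d2].
Qed.

Lemma retr_mulZ m n (M : 'M[C]_(m, n)) (N : 'M[C]_(n, m)) a :
  retr (M *m (a%:C *: N)) = a * retr (M *m N).
Proof. by rewrite -scalemxAr retrZ. Qed.

Lemma retr_rot4 m1 m2 m3 m4 (M1 : 'M[C]_(m1, m2)) (M2 : 'M[C]_(m2, m3))
    (M3 : 'M[C]_(m3, m4)) (M4 : 'M[C]_(m4, m1)) :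
  retr (M1 *m M2 *m M3 *m M4) = retr (M2 *m M3 *m M4 *m M1).
Proof. by rewrite -mulmxA -mulmxA retrC mulmxA. Qed.

(** * A pair of operators in their two eigenbases, with squared overlaps [w j i] *)

Section Spectral.
Variables (n : nat) (U V : 'M[C]_n) (r s : 'rV[R]_n).
Hypotheses (uU : unitary U) (uV : unitary V).
Local Notation P := (V *m U^t*).
Local Notation rho := (U^t* *m rdiag r *m U).
Local Notation sigma := (V^t* *m rdiag s *m V).
Local Notation w j i := (sqmod (P j i)).

Let UtK k (M : 'M[C]_(k, n)) : M *m U^t* *m U = M.
Proof. by rewrite -mulmxA uU.2 mulmx1. Qed.

Let VK k (M : 'M[C]_(k, n)) : M *m V *m V^t* = M.
Proof. by rewrite -mulmxA uV.1 mulmx1. Qed.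

Let VtK k (M : 'M[C]_(k, n)) : M *m V^t* *m V = M.
Proof. by rewrite -mulmxA uV.2 mulmx1. Qed.

Let adjP : P^t* = U *m V^t*. Proof. by rewrite adjmxM trmxCK. Qed.

Lemma overlap_sum i : \sum_j w j i = 1.
Proof.
have : (P^t* *m P) i i = 1.
  by rewrite adjP mulmxA VtK uU.1 !mxE eqxx.
by rewrite adj_mulmxE => /(congr1 (@complex.Re R)).
Qed.

Lemma overlap_diagE j : (P *m rdiag r *m P^t*) j j = (\sum_i w j i * r 0 i)%:C.
Proof.
rewrite mulmx_entry raddf_sum; apply: eq_bigr => i _.
rewrite /rdiag mul_mx_diag mxE adjmx_entry mulrAC sqmodE.
by rewrite -[_ 0 i]/(map_mx _ r 0 i) map_mxE -rmorphM.
Qed.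

Lemma retr_mul_mxfun (g : R -> R) :
  retr (rho *m mxfun g sigma) = \sum_j \sum_i w j i * r 0 i * g (s 0 j).
Proof.
rewrite mxfun_diag //.
have -> : retr (rho *m (V^t* *m rdiag (map_mx g s) *m V)) =
    retr (rdiag (map_mx g s) *m (P *m rdiag r *m P^t*)).
  rewrite [RHS]retrC -[RHS](retr_unitary _ uV); congr (retr _).
  by rewrite adjP; apply: mulmx_conjugate; exact: uV.2.
rewrite retr_rdiag_mul; apply: eq_bigr => j _.
by rewrite overlap_diagE map_mxE /= mulrC mulr_suml.
Qed.

(** Since the overlaps sum to 1 over [j], the entropy term also spreads over pairs. The result is
    the classical relative entropy of the weights [w j i * r i] and [w j i * s j], the
    Nussbaum-Szkola distributions. *)
Lemma relentE : relent rho sigma =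
  \sum_j \sum_i w j i * r 0 i * (ln (r 0 i) - ln (s 0 j)).
Proof.
have hr : retr (rho *m mxfun (@ln R) rho) = \sum_i r 0 i * ln (r 0 i).
  by apply: oppr_inj; rewrite -(vnent_diag r uU).
rewrite /relent retr_mul_mxfun hr.
transitivity (\sum_j \sum_i w j i * r 0 i * ln (r 0 i) -
              \sum_j \sum_i w j i * r 0 i * ln (s 0 j)).
  congr (_ - _); rewrite exchange_big /=; apply: eq_bigr => i _.
  by rewrite -mulr_suml -mulr_suml overlap_sum mul1r.
rewrite -sumrB; apply: eq_bigr => j _; rewrite -sumrB; apply: eq_bigr => i _.
by rewrite mulrBr.
Qed.

Lemma sum_overlap : \sum_j \sum_i w j i * r 0 i = retr rho.
Proof.
rewrite retr_conj // exchange_big; apply: eq_bigr => i _.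
by rewrite -mulr_suml overlap_sum mul1r.
Qed.

(** The kernel condition is tested on the eigenvector of [sigma] for [s j]: the expectation of [rho]
    there is a vanishing sum of nonnegative terms [w j i * r i]. *)
Lemma overlap_support : (forall i, 0 <= r 0 i) ->
    (forall v : 'cV[C]_n, (v^t* *m sigma *m v) 0 0 = 0 -> (v^t* *m rho *m v) 0 0 = 0) ->
  forall j i, s 0 j = 0 -> w j i * r 0 i = 0.
Proof.
move=> r0 hker j i sj0.
have := hker ((row j V)^t*); rewrite !mulmx_rowE !mulmxA uV.1 mul1mx VK.
rewrite -[V *m U^t* *m _ *m _ *m _]mulmxA -adjP overlap_diagE rdiagE eqxx mulr1n sj0.
move=> /(_ erefl)/complexI/eqP; rewrite psumr_eq0 => [/allP/(_ i)|k _].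
  by rewrite mem_index_enum => /(_ isT)/eqP.
by rewrite mulr_ge0 // sqmod_ge0.
Qed.

(** Reading [B] from the eigenbasis of [rho] to that of [sigma] decouples the entries, so the
    maximisation can be done one complex number at a time. *)
Lemma quadraticE t (X : 'M[C]_n) : quadratic rho sigma t (V^t* *m X *m U) =
  \sum_j \sum_i (2 * (r 0 i * (complex.Re (P j i) * complex.Re (X j i)
                              + complex.Im (P j i) * complex.Im (X j i)))
    - (s 0 j + t * r 0 i) * sqmod (X j i)).
Proof.
have e1 : retr (rho *m (V^t* *m X *m U)) = \sum_j \sum_i r 0 i *
    (complex.Re (P j i) * complex.Re (X j i) + complex.Im (P j i) * complex.Im (X j i)).
  have -> : rho *m (V^t* *m X *m U) = U^t* *m (rdiag r *m (P^t* *m X)) *m U.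
    by rewrite adjP !mulmxA.
  rewrite retr_unitary // retr_rdiag_mul exchange_big; apply: eq_bigr => i _ /=.
  rewrite -mulr_sumr mulmx_entry Re_sum; congr (_ * _); apply: eq_bigr => j _.
  by rewrite adjmx_entry Re_conjM.
have e2 : retr ((V^t* *m X *m U)^t* *m sigma *m (V^t* *m X *m U)) =
    \sum_j \sum_i s 0 j * sqmod (X j i).
  have -> : (V^t* *m X *m U)^t* *m sigma *m (V^t* *m X *m U) =
      U^t* *m (X^t* *m (rdiag s *m X)) *m U.
    by rewrite !adjmxM trmxCK; exact: mulmx_sandwich uV.1.
  rewrite retr_unitary // retrC -mulmxA retr_rdiag_mul.
  by apply: eq_bigr => j _; rewrite mulmx_adjE mulr_sumr.
have e3 : retr ((V^t* *m X *m U) *m rho *m (V^t* *m X *m U)^t*) =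
    \sum_j \sum_i r 0 i * sqmod (X j i).
  have -> : (V^t* *m X *m U) *m rho *m (V^t* *m X *m U)^t* =
      V^t* *m (X *m (rdiag r *m X^t*)) *m V.
    rewrite !adjmxM trmxCK -[V^t* *m X *m U]mulmxA [U^t* *m (X^t* *m V)]mulmxA.
    exact: mulmx_sandwich uU.1.
  rewrite retr_unitary // retrC -mulmxA retr_rdiag_mul exchange_big.
  by apply: eq_bigr => i _ /=; rewrite adj_mulmxE mulr_sumr.
have quadE x x' y y' z z' : x = x' -> y = y' -> z = z' ->
  2 * x - y - t * z = 2 * x' - y' - t * z' by move=> -> -> ->.
apply: (etrans (quadE _ _ _ _ _ _ e1 e2 e3)).
rewrite !mulr_sumr -!sumrB; apply: eq_bigr => j _.
by rewrite !mulr_sumr -!sumrB; apply: eq_bigr => i _; ring.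
Qed.

Hypotheses (r_ge0 : forall i, 0 <= r 0 i) (s_ge0 : forall i, 0 <= s 0 i).

Lemma quadratic_le t (B : 'M[C]_n) : 0 < t ->
  quadratic rho sigma t B <=
    \sum_j \sum_i w j i * (r 0 i ^+ 2 / (s 0 j + t * r 0 i)).
Proof.
move=> t0; have -> : B = V^t* *m (V *m B *m U^t*) *m U by rewrite !mulmxA uV.2 mul1mx UtK.
rewrite quadraticE; apply: ler_sum => j _; apply: ler_sum => i _.
apply: complete_square; first by rewrite addr_ge0 // mulr_ge0 // ltW.
(* A vanishing denominator is a sum of nonnegative terms, and [t > 0] then gives [r i = 0]. *)
move/eqP; rewrite paddr_eq0 ?(mulr_ge0 (ltW t0)) // => /andP[_].
by rewrite mulf_eq0 (gt_eqF t0) => /eqP.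
Qed.

Lemma quadratic_max t : 0 < t -> exists B : 'M[C]_n,
  quadratic rho sigma t B = \sum_j \sum_i w j i * (r 0 i ^+ 2 / (s 0 j + t * r 0 i)).
Proof.
(* The entrywise maximiser from [complete_square]. *)
move=> t0; pose X : 'M[C]_n := \matrix_(j, i) ((r 0 i / (s 0 j + t * r 0 i))%:C * P j i).
exists (V^t* *m X *m U); rewrite quadraticE.
apply: eq_bigr => j _; apply: eq_bigr => i _.
have -> : X j i = (r 0 i / (s 0 j + t * r 0 i))%:C * P j i by rewrite mxE.
move: (P j i) => [a b]; rewrite /sqmod /=; move: (r 0 i) (s 0 j) => x y.
(* With a zero denominator the entry of [X] is 0 and both sides vanish. *)
have [->|d0] := eqVneq (y + t * x) 0.
  by rewrite invr0; ring.
by field.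
Qed.

End Spectral.

(** An operator Schwarz inequality. The difference of the two sides is the average of the
    nonnegative traces for [Y e - B *m (K e)^t*], a variance, once completeness of the [K e] has
    collapsed the cross terms. *)
Lemma psd_schwarz (E : finType) n m (q : E -> R) (K : E -> 'M[C]_(m, n))
    (Y : E -> 'M[C]_(n, m)) (M : 'M[C]_n) (B := \sum_e (q e)%:C *: (Y e *m K e)) :
    psd M -> (forall e, 0 <= q e) ->
    \sum_e (q e)%:C *: ((K e)^t* *m K e) = 1%:M ->
  retr (B^t* *m M *m B) <= \sum_e q e * retr ((Y e)^t* *m M *m Y e).
Proof.
move=> hM q0 hK; have defB : \sum_e (q e)%:C *: (Y e *m K e) = B by [].
move: B defB => B defB; rewrite -subr_ge0.
have <- : \sum_e q e * retr ((Y e - B *m (K e)^t*)^t* *m M *m (Y e - B *m (K e)^t*)) =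
    \sum_e q e * retr ((Y e)^t* *m M *m Y e) - retr (B^t* *m M *m B).
  have e1 e : q e * retr ((Y e - B *m (K e)^t*)^t* *m M *m (Y e - B *m (K e)^t*)) =
      q e * retr ((Y e)^t* *m M *m Y e)
      - 2 * retr (B^t* *m M *m ((q e)%:C *: (Y e *m K e)))
      + retr (B^t* *m M *m B *m ((q e)%:C *: ((K e)^t* *m K e))).
    have -> : (Y e - B *m (K e)^t*)^t* = (Y e)^t* - K e *m B^t*.
      by rewrite adjmxB adjmxM trmxCK.
    have ringE (a b c d x y : R) : b = c -> x = q e * c -> y = q e * d ->
        q e * (a - b - c + d) = q e * a - 2 * x + y by move=> -> -> ->; ring.
    apply: (etrans (congr1 _ (retr_subB _ _ _ _ _ _ _))).
    apply: ringE; [|exact: retr_mulZ|exact: retr_mulZ].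
    apply: (etrans (esym (retr_adj _))); rewrite !adjmxM !trmxCK (psd_herm hM).
    by rewrite -!mulmxA; apply: (etrans (retrC _ _)); rewrite !mulmxA.
  transitivity (\sum_e q e * retr ((Y e)^t* *m M *m Y e)
      - 2 * \sum_e retr (B^t* *m M *m ((q e)%:C *: (Y e *m K e)))
      + \sum_e retr (B^t* *m M *m B *m ((q e)%:C *: ((K e)^t* *m K e)))).
    by rewrite mulr_sumr -sumrB -big_split; apply: eq_bigr => e _; exact: e1.
  have -> : \sum_e retr (B^t* *m M *m ((q e)%:C *: (Y e *m K e))) = retr (B^t* *m M *m B).
    by rewrite -retr_sum -mulmx_sumr defB.
  have -> : \sum_e retr (B^t* *m M *m B *m ((q e)%:C *: ((K e)^t* *m K e))) =
      retr (B^t* *m M *m B).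
    by rewrite -retr_sum -mulmx_sumr hK mulmx1.
  by move: (retr _) (\sum_e _) => x y; ring.
by apply: sumr_ge0 => e _; rewrite mulr_ge0 // psd_retr.
Qed.

(** For the combined candidate the linear term is unchanged, while each quadratic term, which is
    subtracted, can only shrink by [psd_schwarz]. *)
Lemma quadratic_mono (E : finType) n m (q : E -> R) (K : E -> 'M[C]_(m, n))
    (M N : 'M[C]_n) t (B : E -> 'M[C]_m) :
    psd M -> psd N -> 0 < t -> (forall e, 0 <= q e) ->
    \sum_e (q e)%:C *: ((K e)^t* *m K e) = 1%:M ->
  \sum_e q e * quadratic (K e *m M *m (K e)^t*) (K e *m N *m (K e)^t*) t (B e)
    <= quadratic M N t (\sum_e (q e)%:C *: ((K e)^t* *m B e *m K e)).
Proof.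
move=> hM hN t0 q0 hK; set D := \sum_e _ *: _.
have aD : D^t* = \sum_e (q e)%:C *: ((K e)^t* *m (B e)^t* *m K e).
  by rewrite adjmx_sum; apply: eq_bigr => e _; rewrite adjmxZ !adjmxM trmxCK mulmxA.
have h1 := @psd_schwarz E n m q K (fun e => (K e)^t* *m B e) N hN q0 hK.
have h2 := @psd_schwarz E n m q K (fun e => (K e)^t* *m (B e)^t*) M hM q0 hK.
rewrite /= -/D in h1; rewrite /= -aD trmxCK in h2.
have -> : \sum_e q e * quadratic (K e *m M *m (K e)^t*) (K e *m N *m (K e)^t*) t (B e)
   = 2 * retr (M *m D)
     - \sum_e q e * retr (((K e)^t* *m B e)^t* *m N *m ((K e)^t* *m B e))
     - t * \sum_e q e * retr (((K e)^t* *m (B e)^t*)^t* *m M *m ((K e)^t* *m (B e)^t*)).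
  rewrite mulmx_sumr retr_sum !mulr_sumr -!sumrB; apply: eq_bigr => e _.
  rewrite /quadratic !adjmxM !trmxCK retr_mulZ !mulmxA.
  have ringE (x x' y z : R) : x = x' ->
    q e * (2 * x - y - t * z) = 2 * (q e * x') - q e * y - t * (q e * z) by move=> ->; ring.
  by apply: ringE; exact: retr_rot4.
by rewrite /quadratic; apply: lerB; [apply: lerB|rewrite ler_pM2l].
Qed.

(** Both relative entropies are sums over pairs of eigenvalues, so their difference is one signed
    sum to which [sum_ln_ge0] applies. *)
Theorem relent_mono (E : finType) n m (q : E -> R) (K : E -> 'M[C]_(m, n)) (M N : 'M[C]_n) :
    psd M -> psd N -> (forall e, 0 <= q e) ->
    \sum_e (q e)%:C *: ((K e)^t* *m K e) = 1%:M ->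
    (forall v : 'cV[C]_n, (v^t* *m N *m v) 0 0 = 0 -> (v^t* *m M *m v) 0 0 = 0) ->
  \sum_e q e * relent (K e *m M *m (K e)^t*) (K e *m N *m (K e)^t*) <= relent M N.
Proof.
move=> hM hN q0 hK hker.
pose M' e := K e *m M *m (K e)^t*; pose N' e := K e *m N *m (K e)^t*.
have hM' e : psd (M' e) by exact: psd_conj.
have hN' e : psd (N' e) by exact: psd_conj.
have hker' e (v : 'cV[C]_m) : (v^t* *m N' e *m v) 0 0 = 0 -> (v^t* *m M' e *m v) 0 0 = 0.
  by have := hker ((K e)^t* *m v); rewrite adjmxM trmxCK !mulmxA.
have eigP k (L : 'M[C]_k) : psd L -> exists (W : 'M[C]_k) (l : 'rV[R]_k),
    [/\ unitary W, forall i, 0 <= l 0 i & L = W^t* *m rdiag l *m W].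
  move=> hL; exists (spectralmx L), (eigenval L).
  by split; [exact: spectral_unitary|move=> i; exact: psd_eigenval|exact: spectral_psd].
have [U [r [uU r0 eM]]] := eigP _ _ hM; have [V [s [uV s0 eN]]] := eigP _ _ hN.
have /choice[U' /choice[r' h']] e := eigP _ _ (hM' e).
have /choice[V' /choice[s' h'']] e := eigP _ _ (hN' e).
have uU' e : unitary (U' e) by have [] := h' e.
have r0' e : forall i, 0 <= r' e 0 i by have [] := h' e.
have eM' e : M' e = (U' e)^t* *m rdiag (r' e) *m U' e by have [] := h' e.
have uV' e : unitary (V' e) by have [] := h'' e.
have s0' e : forall i, 0 <= s' e 0 i by have [] := h'' e.
have eN' e : N' e = (V' e)^t* *m rdiag (s' e) *m V' e by have [] := h'' e.
pose w (x : 'I_n * 'I_n) := sqmod ((V *m U^t*) x.1 x.2).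
pose w' e (x : 'I_m * 'I_m) := sqmod ((V' e *m (U' e)^t*) x.1 x.2).
(* Pairs of eigenvalues before the measurement count positively, pairs after it negatively and with
   their outcome [e]. *)
pose a (x : ('I_n * 'I_n) + (E * ('I_m * 'I_m))) : R := match x with
  | inl x => w x * r 0 x.2 | inr (e, x) => - (q e * (w' e x * r' e 0 x.2)) end.
pose rr (x : ('I_n * 'I_n) + (E * ('I_m * 'I_m))) : R := match x with
  | inl x => r 0 x.2 | inr (e, x) => r' e 0 x.2 end.
pose ss (x : ('I_n * 'I_n) + (E * ('I_m * 'I_m))) : R := match x with
  | inl x => s 0 x.1 | inr (e, x) => s' e 0 x.1 end.
have sumE (F : R -> R -> R) : \sum_x a x * F (rr x) (ss x) =
    \sum_j \sum_i sqmod ((V *m U^t*) j i) * r 0 i * F (r 0 i) (s 0 j)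
    - \sum_e q e * \sum_j \sum_i sqmod ((V' e *m (U' e)^t*) j i) * r' e 0 i
                                 * F (r' e 0 i) (s' e 0 j).
  rewrite big_sumType /= -sumrN; congr (_ + _); first by rewrite pair_bigA.
  transitivity (\sum_e \sum_x - (q e * (w' e x * r' e 0 x.2)) *
    F (r' e 0 x.2) (s' e 0 x.1)).
    by rewrite [RHS]pair_bigA; apply: eq_bigr => -[e x] _.
  apply: eq_bigr => e _.
  rewrite pair_bigA mulr_sumr -sumrN; apply: eq_bigr => x _.
  by rewrite /w' mulNr -[in LHS]mulrA.
(* The total weight is zero because the measurement preserves the trace. *)
have suma : \sum_x a x = 0.
  have := sumE (fun _ _ => 1); under eq_bigr do rewrite mulr1; move=> ->.
  under eq_bigr do under eq_bigr do rewrite mulr1.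
  rewrite sum_overlap // -eM; apply/eqP; rewrite subr_eq0; apply/eqP.
  transitivity (\sum_e q e * retr (M' e)).
    rewrite -[M in LHS]mulmx1 -hK mulmx_sumr retr_sum; apply: eq_bigr => e _.
    by rewrite retr_mulZ; congr (_ * _); rewrite mulmxA retrC mulmxA.
  apply: eq_bigr => e _; rewrite [in LHS]eM' -(sum_overlap (r' e) (uU' e) (uV' e)).
  by congr (_ * _); do 2!apply: eq_bigr => ? _; rewrite mulr1.
have a_gt0 x : a x != 0 -> 0 < rr x /\ 0 < ss x.
  case: x => [[j i]|[e [j i]]] /=.
    move=> ax; rewrite !lt_def r0 s0 !andbT; split.
      by apply: contra ax => /eqP ->; rewrite mulr0.
    apply: contra ax => /eqP sj; apply/eqP.
    by apply: (overlap_support uV r0 _ i sj) => v; rewrite -eM -eN; exact: hker.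
  move=> ax; rewrite !lt_def r0' s0' !andbT; split.
    by apply: contra ax => /eqP ->; rewrite !mulr0 oppr0.
  apply: contra ax => /eqP sj; rewrite oppr_eq0 mulf_eq0; apply/orP; right; apply/eqP.
  by apply: (overlap_support (uV' e) (r0' e) _ i sj) => v; rewrite -eM' -eN'; exact: hker'.
(* For each [t] the optimal [B e] after the measurement combine into a candidate before it, whose
   value is at most the optimum there. *)
have a_int (t : R) : 0 < t -> 0 <= \sum_x a x * (rr x / (ss x + t * rr x)).
  move=> t0; rewrite (sumE (fun u v => u / (v + t * u))) subr_ge0.
  have /choice[B hB] e := quadratic_max (r' e) (s' e) (uU' e) (uV' e) t0.
  have := quadratic_mono B hM hN t0 q0 hK.
  rewrite [in X in _ <= X -> _]eM [in X in _ <= X -> _]eN => h.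
  have := le_trans h (quadratic_le uU uV r0 s0 _ t0).
  rewrite [leLHS](_ : _ = \sum_e q e * \sum_j \sum_i
     sqmod ((V' e *m (U' e)^t*) j i) * (r' e 0 i ^+ 2 / (s' e 0 j + t * r' e 0 i))).
    move=> h2; apply: (le_trans _ (le_trans h2 _)); rewrite le_eqVlt; apply/orP; left; apply/eqP.
      apply: eq_bigr => e _; congr (_ * _).
      by do 2!apply: eq_bigr => ? _; rewrite expr2 !mulrA.
    by do 2!apply: eq_bigr => ? _; rewrite expr2 !mulrA.
  by apply: eq_bigr => e _; rewrite -hB -eM' -eN'.
have := sum_ln_ge0 a_gt0 suma a_int.
rewrite (sumE (fun u v => ln u - ln v)) subr_ge0.
rewrite [in relent M N]eM [in relent _ N]eN relentE //.
rewrite (eq_bigr (fun e => q e * relent (M' e) (N' e))) // => e _.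
by rewrite [in RHS]eM' [in RHS]eN' relentE.
Qed.

End Monotonicity.
(** * Two measurements of a purifying register *)

Section Tradeoff.
Variable R : realType.
Local Notation C := R[i].

Definition sgn (b : bool) : R := if b then -1 else 1.

Lemma sgn_mul b : sgn b * sgn b = 1.
Proof. by case: b; rewrite /= ?mulrNN mulr1. Qed.

(** Orthogonality of the coordinate characters of the sign group: for [k] different from [l],
    flipping the sign at [k] negates the sum. *)
Lemma sum_sgn (I : finType) (k l : I) :
  \sum_(e : {ffun I -> bool}) sgn (e k) * sgn (e l) = (2 ^ #|I|)%:R *+ (k == l).
Proof.
have [<-|kl] := eqVneq k l.
  under eq_bigr do rewrite sgn_mul.
  by rewrite sumr_const card_ffun card_bool mulr1n.
rewrite mulr0n; set S := \sum_e _.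
suff : S = - S by move/eqP; rewrite -subr_eq0 opprK -mulr2n mulrn_eq0 => /eqP.
pose h (e : {ffun I -> bool}) := [ffun i => (i == k) (+) e i].
have hK : involutive h by move=> e; apply/ffunP => i; rewrite !ffunE addbA addbb.
rewrite {1}/S (reindex_inj (inv_inj hK)) -sumrN; apply: eq_bigr => e _.
rewrite !ffunE eqxx eq_sym (negbTE kl) /= -mulNr; congr (_ * _).
by case: (e k); rewrite /= ?opprK.
Qed.

Definition signweight (I : finType) : R := ((2 ^ #|I|)%:R)^-1.

Definition signed (I : finType) m n (W : I -> 'M[C]_(m, n)) (e : {ffun I -> bool}) :=
  \sum_k (sgn (e k))%:C *: W k.

Lemma adj_signed (I : finType) m n (W : I -> 'M[C]_(m, n)) e :
  (signed W e)^t* = signed (fun k => (W k)^t*) e.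
Proof. by rewrite adjmx_sum; apply: eq_bigr => k _; rewrite adjmxZ. Qed.

Lemma signweight_ge0 (I : finType) : 0 <= signweight I.
Proof. by rewrite invr_ge0. Qed.

Lemma signweight_sum (I : finType) : \sum_(e : {ffun I -> bool}) signweight I = 1.
Proof.
by rewrite sumr_const card_ffun card_bool -[_ *+ _]mulr_natr mulVf // pnatr_eq0 expn_eq0.
Qed.

Lemma average_signed (I : finType) m n p (X : I -> 'M[C]_(m, n)) (Y : I -> 'M[C]_(n, p)) :
  \sum_e (signweight I)%:C *: (signed X e *m signed Y e) = \sum_k X k *m Y k.
Proof.
have avg_sgn k l : \sum_(e : {ffun I -> bool}) signweight I * (sgn (e k) * sgn (e l)) =
    (k == l)%:R.
  by rewrite -mulr_sumr sum_sgn mulrnAr mulVf // pnatr_eq0 expn_eq0.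
have E (e : {ffun I -> bool}) : (signweight I)%:C *: (signed X e *m signed Y e) =
    \sum_k \sum_l (signweight I * (sgn (e k) * sgn (e l)))%:C *: (X k *m Y l).
  rewrite mulmx_suml scaler_sumr; apply: eq_bigr => k _.
  rewrite mulmx_sumr scaler_sumr; apply: eq_bigr => l _.
  by rewrite -scalemxAl -scalemxAr !scalerA -!rmorphM mulrA.
rewrite (eq_bigr _ (fun e _ => E e)) exchange_big.
apply: eq_bigr => k _; rewrite exchange_big (bigD1 k) //= [X in _ + X]big1 ?addr0 => [|l lk].
  by rewrite -scaler_suml -rmorph_sum avg_sgn eqxx scale1r.
by rewrite -scaler_suml -rmorph_sum avg_sgn eq_sym (negbTE lk) scale0r.
Qed.

Section Register.
Variables (I : finType) (m : nat).

(* The isometry a |-> |k> (x) a. *)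
Definition register (k : I) : 'M[C]_(#|{: I * 'I_m}|, m) :=
  \matrix_(x, i) (enum_val x == (k, i))%:R.

Lemma register_entry k x i : register k x i = (enum_val x == (k, i))%:R.
Proof. by rewrite mxE. Qed.

Lemma adj_register_entry k x i : ((register k)^t*) i x = (enum_val x == (k, i))%:R.
Proof. by rewrite adjmx_entry register_entry conjc_nat. Qed.

Lemma register_isom k : (register k)^t* *m register k = 1%:M.
Proof.
apply/matrixP => i j; rewrite mulmx_entry (bigD1 (enum_rank (k, i))) //= big1.
  by rewrite addr0 adj_register_entry register_entry enum_rankK eqxx mul1r !mxE xpair_eqE eqxx.
move=> x xki; rewrite adj_register_entry; case: eqP => [e|]; last by rewrite mul0r.
by rewrite -e enum_valK eqxx in xki.
Qed.

Lemma register_ortho k l : k != l -> (register k)^t* *m register l = 0.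
Proof.
move=> kl; apply/matrixP => i j; rewrite mulmx_entry big1 ?mxE // => x _.
rewrite adj_register_entry register_entry; case: eqP => [->|]; last by rewrite mul0r.
by rewrite xpair_eqE (negbTE kl) mulr0.
Qed.

Lemma register_sum : \sum_k register k *m (register k)^t* = 1%:M.
Proof.
apply/matrixP => x y; rewrite summxE.
have [k i] : exists k i, enum_val x = (k, i) by case: (enum_val x) => k i; exists k, i.
case: i => i ex.
rewrite (bigD1 k) //= big1 ?addr0 => [|l lk].
  rewrite mulmx_entry (bigD1 i) //= big1 ?addr0 => [|j ji].
    rewrite adj_register_entry register_entry ex eqxx mul1r mxE.
    by rewrite -ex (inj_eq enum_val_inj) eq_sym.
  by rewrite register_entry ex xpair_eqE eqxx [i == j]eq_sym (negbTE ji) mul0r.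
rewrite mulmx_entry big1 // => j _.
by rewrite register_entry ex xpair_eqE eq_sym (negbTE lk) mul0r.
Qed.

End Register.

Lemma psd_add_sum (I : finType) n (M : I -> 'M[C]_n) :
  (forall i, psd (M i)) -> psd (\sum_i M i).
Proof.
move=> h; have := psd_sum (q := fun=> 1) (fun=> ler01) h.
by under eq_bigr do rewrite scale1r.
Qed.

Lemma gram_eq0 m (X : 'cV[C]_m) : (X^t* *m X) 0 0 = 0 -> X = 0.
Proof.
rewrite adj_mulmxE => /complexI/eqP; rewrite psumr_eq0 => [/allP h|i _]; last exact: sqmod_ge0.
apply/matrixP => i j; rewrite ord1 mxE; have := h i; rewrite mem_index_enum => /(_ isT).
by rewrite sqmod_eq0 => /eqP.
Qed.

Variables (I : finType) (m n : nat) (W : I -> 'M[C]_(m, n)).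

Let J := @register I m.
Let q := signweight I.
(** [rho] is the joint state of the register and the left system, [sigma] its dephasing in the
    register basis, and [K e] contracts the register with the sign vector [e]. *)
Let WW : 'M[C]_(#|{: I * 'I_m}|, n) := \sum_k J k *m W k.
Let rho := WW *m WW^t*.
Let sigma := \sum_k J k *m (W k *m (W k)^t*) *m (J k)^t*.
Let K := signed (fun k => (J k)^t*).

Let adjJ_WW k : (J k)^t* *m WW = W k.
Proof.
rewrite mulmx_sumr (bigD1 k) //= mulmxA register_isom mul1mx big1 ?addr0 // => l lk.
by rewrite mulmxA register_ortho ?mul0mx // eq_sym.
Qed.

Let K_J e k : K e *m J k = (sgn (e k))%:C%:M.
Proof.
rewrite mulmx_suml (bigD1 k) //= big1 ?addr0 => [|l lk].
  by rewrite -scalemxAl register_isom scalemx1.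
by rewrite -scalemxAl register_ortho ?scaler0.
Qed.

Let K_WW e : K e *m WW = signed W e.
Proof.
rewrite mulmx_sumr; apply: eq_bigr => k _.
by rewrite mulmxA K_J mul_scalar_mx.
Qed.

Let K_rho e : K e *m rho *m (K e)^t* = signed W e *m (signed W e)^t*.
Proof. by rewrite -K_WW adjmxM !mulmxA. Qed.

(** Each diagonal block picks up its sign twice, so every outcome leaves the same operator: the
    dephased register carries no information about the sign measurement. *)
Let K_sigma e : K e *m sigma *m (K e)^t* = \sum_k W k *m (W k)^t*.
Proof.
rewrite mulmx_sumr mulmx_suml; apply: eq_bigr => k _.
have -> : K e *m (J k *m (W k *m (W k)^t*) *m (J k)^t*) *m (K e)^t* =
    K e *m J k *m (W k *m (W k)^t*) *m (K e *m J k)^t*.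
  by rewrite adjmxM !mulmxA.
rewrite K_J mul_scalar_mx.
have -> : ((sgn (e k))%:C%:M : 'M[C]_m)^t* = (sgn (e k))%:C%:M.
  by rewrite -scalemx1 adjmxZ adjmx1.
by rewrite mul_mx_scalar scalerA -rmorphM sgn_mul scale1r.
Qed.

Let K_sum : \sum_e q%:C *: ((K e)^t* *m K e) = 1%:M.
Proof.
rewrite -[RHS](@register_sum I m) -average_signed; apply: eq_bigr => e _.
by have -> : (K e)^t* = signed J e by rewrite adj_signed; apply: eq_bigr => k _; rewrite trmxCK.
Qed.

Let psd_sigma : psd sigma.
Proof. by apply: psd_add_sum => k; apply: psd_conj; exact: psd_gram. Qed.

(** The expectation of [sigma] is the sum of the squared norms of the vectors [X k], that of [rho]
    the squared norm of their sum. *)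
Let ker_sigma (v : 'cV[C]__) : (v^t* *m sigma *m v) 0 0 = 0 -> (v^t* *m rho *m v) 0 0 = 0.
Proof.
pose X k := (W k)^t* *m ((J k)^t* *m v).
have -> : v^t* *m sigma *m v = \sum_k (X k)^t* *m X k.
  rewrite mulmx_sumr mulmx_suml; apply: eq_bigr => k _.
  by rewrite /X !adjmxM !trmxCK !mulmxA.
have -> : v^t* *m rho *m v = (\sum_k X k)^t* *m \sum_k X k.
  have -> : \sum_k X k = WW^t* *m v.
    rewrite adjmx_sum mulmx_suml; apply: eq_bigr => k _.
    by rewrite /X adjmxM mulmxA.
  by rewrite adjmxM trmxCK !mulmxA.
rewrite summxE => h; rewrite (_ : \sum_k X k = 0) ?mulmx0 ?mxE //.
apply: big1 => k _; apply: gram_eq0.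
have Xge0 l : 0 <= ((X l)^t* *m X l) 0 0.
  by rewrite adj_mulmxE ler0c sumr_ge0 // => i _; exact: sqmod_ge0.
have /eqP := h; rewrite psumr_eq0 => [/allP/(_ k)|l _ //].
by rewrite mem_index_enum => /(_ isT)/eqP.
Qed.

Let sigma_J k : sigma *m J k = J k *m (W k *m (W k)^t*).
Proof.
rewrite mulmx_suml (bigD1 k) //= big1 ?addr0 => [|l lk].
  by rewrite -mulmxA register_isom mulmx1.
by rewrite -mulmxA register_ortho // mulmx0.
Qed.

Let adjJ_ln k : (J k)^t* *m mxfun (@ln R) sigma = mxfun (@ln R) (W k *m (W k)^t*) *m (J k)^t*.
Proof.
have /(congr1 (fun X => X^t*)) : mxfun (@ln R) sigma *m J k = J k *m mxfun (@ln R) (W k *m (W k)^t*).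
  by apply: mxfun_intertwine; [exact: psd_herm|exact: adj_gram|exact: sigma_J].
by rewrite !adjmxM !adj_mxfun.
Qed.

(** [rho] is a Gram matrix of [WW], so its entropy is that of the other one. The logarithm of
    [sigma] acts blockwise, which reduces the cross term to the blocks of [rho] on the diagonal. *)
Let relent_rho_sigma : relent rho sigma =
  \sum_k vnent (W k *m (W k)^t*) - vnent (\sum_k (W k)^t* *m W k).
Proof.
have -> : \sum_k (W k)^t* *m W k = WW^t* *m WW.
  rewrite adjmx_sum mulmx_suml; apply: eq_bigr => k _.
  by rewrite adjmxM -mulmxA adjJ_WW.
rewrite -vnent_gramC /relent addrC /vnent opprK; congr (_ + _).
rewrite sumrN; congr (- _).
have -> : rho *m mxfun (@ln R) sigma =
    WW *m \sum_k (W k)^t* *m (mxfun (@ln R) (W k *m (W k)^t*) *m (J k)^t*).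
  rewrite -mulmxA; congr (_ *m _); rewrite adjmx_sum mulmx_suml; apply: eq_bigr => k _.
  by rewrite adjmxM -mulmxA adjJ_ln.
rewrite retrC mulmx_suml retr_sum; apply: eq_bigr => k _.
by rewrite -!mulmxA adjJ_WW [RHS]retrC mulmxA.
Qed.

(* An uncertainty relation between the basis measurement of the register and
   its measurement in the sign vectors: both ensembles cannot carry much
   information about the left system. *)
Theorem vnent_tradeoff :
  vnent (\sum_k W k *m (W k)^t*) + vnent (\sum_k (W k)^t* *m W k) <=
  \sum_k vnent (W k *m (W k)^t*) + \sum_e q * vnent (signed W e *m (signed W e)^t*).
Proof.
have := relent_mono (psd_gram WW) psd_sigma (fun=> signweight_ge0 I) K_sum ker_sigma.
rewrite relent_rho_sigma.
have -> : \sum_e q * relent (K e *m rho *m (K e)^t*) (K e *m sigma *m (K e)^t*) =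
   vnent (\sum_k W k *m (W k)^t*) - \sum_e q * vnent (signed W e *m (signed W e)^t*).
  (* All outcomes share the logarithm of [a], and the measured states average to [a], so the cross
     terms add up to minus its entropy. *)
  set a := \sum_k W k *m (W k)^t*; set L := mxfun (@ln R) a.
  have E e : q * relent (K e *m rho *m (K e)^t*) (K e *m sigma *m (K e)^t*) =
      - retr (q%:C *: (signed W e *m (signed W e)^t*) *m L)
      - q * vnent (signed W e *m (signed W e)^t*).
    rewrite K_rho K_sigma -/a /relent -/L -scalemxAl retrZ /vnent.
    by move: (retr _) (retr _) => x y; ring.
  rewrite (eq_bigr _ (fun e _ => E e)) sumrB sumrN -retr_sum -mulmx_suml.
  have -> : \sum_e q%:C *: (signed W e *m (signed W e)^t*) = a.
    by rewrite /a -average_signed; apply: eq_bigr => e _; rewrite adj_signed.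
  by [].
have swap (x y z t : R) : x - t <= z - y -> x + y <= z + t by lra.
exact: swap.
Qed.

End Tradeoff.
(** * Entanglement of assistance *)

Section EntropyBounds.
Variable R : realType.
Local Notation C := R[i].

Lemma retr_eigenval n (M : 'M[C]_n) : psd M -> retr M = \sum_i eigenval M 0 i.
Proof. by move=> hM; rewrite {1}(spectral_psd hM) retr_conj //; exact: spectral_unitary. Qed.

Lemma vnent_psd n (M : 'M[C]_n) : psd M ->
  vnent M = - \sum_i eigenval M 0 i * ln (eigenval M 0 i).
Proof. by move=> hM; rewrite vnentE //; exact: psd_herm. Qed.

(** A crude bound from [- x ln x <= 1 - x <= 1] for each eigenvalue; it serves to bound the set
    whose supremum is [EOA]. *)
Lemma vnent_le n (M : 'M[C]_n) : psd M -> vnent M <= n%:R.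
Proof.
move=> hM; rewrite vnent_psd // -sumrN -[n in n%:R]card_ord -sumr_const.
apply: ler_sum => i _; have := psd_eigenval i hM; move: (eigenval M 0 i) => x.
rewrite le_eqVlt => /predU1P[<-|x0]; first by rewrite mul0r oppr0 ler01.
rewrite -mulrN -lnV ?posrE //.
have h : ln x^-1 <= x^-1 - 1.
  have := @le_ln1Dx R (x^-1 - 1); rewrite [1 + _]addrC subrK; apply.
  by rewrite ltrBrDr addrC subrr invr_gt0.
apply: (@le_trans _ _ (x * (x^-1 - 1))); first by rewrite ler_pM2l.
by rewrite mulrBr divff ?gt_eqF // mulr1 gerBl ltW.
Qed.

Lemma vnent_ge0 n (M : 'M[C]_n) : psd M -> retr M = 1 -> 0 <= vnent M.
Proof.
move=> hM trM; rewrite vnent_psd // -sumrN; apply: sumr_ge0 => i _.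
rewrite -mulrN mulr_ge0 ?psd_eigenval // oppr_ge0; apply: ln_le0.
rewrite -trM retr_eigenval // (bigD1 i) //= lerDl.
by apply: sumr_ge0 => j _; exact: psd_eigenval.
Qed.

Lemma scale_rdiag n (U : 'M[C]_n) (r : 'rV[R]_n) c :
  c%:C *: (U^t* *m rdiag r *m U) = U^t* *m rdiag (\row_i (c * r 0 i)) *m U.
Proof.
apply: (etrans (scalemxAl _ _ _)); congr (_ *m U).
apply: (etrans (scalemxAr _ _ _)); congr (_ *m _).
by apply/matrixP => i j; rewrite mxE !rdiagE mxE rmorphM mulrnAr.
Qed.

Lemma vnent_scale n (M : 'M[C]_n) c : psd M -> 0 <= c ->
  vnent (c%:C *: M) = c * vnent M - c * ln c * retr M.
Proof.
move=> hM c0; rewrite (vnent_psd hM) (retr_eigenval hM).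
have e : c%:C *: M =
    (spectralmx M)^t* *m rdiag (\row_i (c * eigenval M 0 i)) *m spectralmx M.
  by rewrite -scale_rdiag; congr (_ *: _); exact: spectral_psd.
rewrite e vnent_diag; last exact: spectral_unitary.
rewrite mulrN mulr_sumr -opprD; congr (- _); rewrite mulr_sumr -big_split /=.
apply: eq_bigr => i _; rewrite mxE; have := psd_eigenval i hM.
move: (eigenval M 0 i) c0 => x.
rewrite le_eqVlt => /predU1P[<-|c0]; first by rewrite !mul0r addr0.
rewrite le_eqVlt => /predU1P[<-|x0]; first by rewrite !(mul0r, mulr0) addr0.
by rewrite lnM ?posrE //; ring.
Qed.

End EntropyBounds.

(** * Amplitude matrices, pure-state decompositions and concavity *)

Section Assistance.
Variable R : realType.
Local Notation C := R[i].

Lemma sum_enum_val (T : finType) (V : nmodType) (F : T -> V) :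
  \sum_(x : T) F x = \sum_(i < #|T|) F (enum_val i).
Proof. by rewrite (reindex _ (onW_bij _ (enum_val_bij T))). Qed.

Lemma sum_enum_rank (T : finType) (V : nmodType) (F : 'I_#|T| -> V) :
  \sum_(i < #|T|) F i = \sum_(x : T) F (enum_rank x).
Proof. by rewrite (reindex _ (onW_bij _ (enum_rank_bij T))). Qed.

Definition ket_at (T : finType) (psi : ket R T) (x : T) : C := psi (enum_rank x) 0.

Lemma op_of_funE (T : finType) (f : T -> T -> C) x y : op_entry (op_of_fun f) x y = f x y.
Proof. by rewrite /op_entry mxE !enum_rankK. Qed.

Lemma op_entryP (T : finType) (M N : op R T) :
  (forall x y, op_entry M x y = op_entry N x y) -> M = N.
Proof.
move=> h; apply/matrixP => i j.
by have := h (enum_val i) (enum_val j); rewrite /op_entry !enum_valK.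
Qed.

Lemma op_entry_ketbra (T : finType) (psi : ket R T) x y :
  op_entry (ketbra psi) x y = ket_at psi x * conjc (ket_at psi y).
Proof. by rewrite /op_entry mulmx_entry big_ord1 adjmx_entry. Qed.

Lemma op_entry_sum (T : finType) (I : finType) (p : I -> R) (M : I -> op R T) x y :
  op_entry (\sum_i (p i)%:C *: M i) x y = \sum_i (p i)%:C * op_entry (M i) x y.
Proof. by rewrite /op_entry summxE; apply: eq_bigr => i _; rewrite mxE. Qed.

Lemma unit_ketE (T : finType) (psi : ket R T) :
  unit_ket psi <-> \sum_x sqmod (ket_at psi x) = 1.
Proof.
rewrite -(sum_enum_rank (fun i => sqmod (psi i 0))).
have e : (psi^t* *m psi) 0 0 = (\sum_i sqmod (psi i 0))%:C by exact: adj_mulmxE.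
split => [h|h]; first by apply: complexI; rewrite -e h mxE.
by apply/matrixP => i j; rewrite !ord1 e h mxE.
Qed.

(** The amplitudes of a bipartite ket; its two Gram matrices are the reduced operators, the second
    one transposed. *)
Definition coefmx (X Y : finType) (psi : ket R (X * Y)%type) : 'M[C]_(#|X|, #|Y|) :=
  \matrix_(i, j) ket_at psi (enum_val i, enum_val j).

Lemma coefmxE (X Y : finType) (psi : ket R (X * Y)%type) i j :
  coefmx psi i j = ket_at psi (enum_val i, enum_val j).
Proof. by rewrite mxE. Qed.

Lemma coefmx_sum (X Y I : finType) (a : I -> R) (psi : I -> ket R (X * Y)%type) :
  coefmx (\sum_i (a i)%:C *: psi i) = \sum_i (a i)%:C *: coefmx (psi i).
Proof.
apply/matrixP => i j; rewrite coefmxE summxE /ket_at summxE.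
by apply: eq_bigr => k _; rewrite mxE [in RHS]mxE coefmxE.
Qed.

Lemma coefmxZ (X Y : finType) (a : C) (psi : ket R (X * Y)%type) :
  coefmx (a *: psi) = a *: coefmx psi.
Proof. by apply/matrixP => i j; rewrite coefmxE [RHS]mxE coefmxE /ket_at mxE. Qed.

Lemma ptr_snd_ketbra (X Y : finType) (psi : ket R (X * Y)%type) :
  partial_trace_snd (ketbra psi) = coefmx psi *m (coefmx psi)^t*.
Proof.
apply/matrixP => i j; rewrite mxE mulmx_entry sum_enum_val; apply: eq_bigr => k _.
by rewrite op_entry_ketbra adjmx_entry !coefmxE.
Qed.

(* The transpose of the reduced operator on the second factor. *)
Definition ptr_fst_tr (X Y : finType) (rho : op R (X * Y)%type) : op R Y :=
  op_of_fun (fun y y' => \sum_(x : X) op_entry rho (x, y') (x, y)).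

Lemma ptr_fst_tr_ketbra (X Y : finType) (psi : ket R (X * Y)%type) :
  ptr_fst_tr (ketbra psi) = (coefmx psi)^t* *m coefmx psi.
Proof.
apply/matrixP => i j; rewrite mxE mulmx_entry sum_enum_val; apply: eq_bigr => k _.
by rewrite op_entry_ketbra adjmx_entry !coefmxE mulrC.
Qed.

Lemma ptr_snd_sum (X Y I : finType) (p : I -> R) (M : I -> op R (X * Y)%type) :
  partial_trace_snd (\sum_i (p i)%:C *: M i) = \sum_i (p i)%:C *: partial_trace_snd (M i).
Proof.
apply/op_entryP => x y; rewrite op_entry_sum op_of_funE.
under eq_bigr do rewrite op_entry_sum.
rewrite exchange_big; apply: eq_bigr => i _; rewrite -mulr_sumr.
by rewrite op_of_funE.
Qed.

Lemma ptr_fst_tr_sum (X Y I : finType) (p : I -> R) (M : I -> op R (X * Y)%type) :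
  ptr_fst_tr (\sum_i (p i)%:C *: M i) = \sum_i (p i)%:C *: ptr_fst_tr (M i).
Proof.
apply/op_entryP => x y; rewrite op_entry_sum op_of_funE.
under eq_bigr do rewrite op_entry_sum.
rewrite exchange_big; apply: eq_bigr => i _; rewrite -mulr_sumr.
by rewrite op_of_funE.
Qed.

Lemma entropyE (T : finType) (rho : op R T) : entropy rho = vnent rho.
Proof. by rewrite /vnent retr.unlock mxfun.unlock. Qed.

Lemma ent_entropyE (X Y : finType) (psi : ket R (X * Y)%type) :
  entanglement_entropy psi = vnent (coefmx psi *m (coefmx psi)^t*).
Proof. by rewrite /entanglement_entropy entropyE ptr_snd_ketbra. Qed.

Lemma retr_coefmx (X Y : finType) (psi : ket R (X * Y)%type) : unit_ket psi ->
  retr (coefmx psi *m (coefmx psi)^t*) = 1.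
Proof.
move/unit_ketE; rewrite retr.unlock /mxtrace Re_sum => <-.
transitivity (\sum_x \sum_y sqmod (ket_at psi (x, y))); last first.
  by rewrite pair_bigA; apply: eq_bigr => -[].
rewrite [RHS]sum_enum_val.
apply: eq_bigr => i _; rewrite mulmx_adjE /= [RHS]sum_enum_val.
by apply: eq_bigr => j _; rewrite coefmxE.
Qed.

Lemma ent_entropy_ge0 (X Y : finType) (psi : ket R (X * Y)%type) : unit_ket psi ->
  0 <= entanglement_entropy psi.
Proof.
move=> h; rewrite ent_entropyE; apply: vnent_ge0; first exact: psd_gram.
exact: retr_coefmx.
Qed.

Lemma ent_entropy_le (X Y : finType) (psi : ket R (X * Y)%type) :
  entanglement_entropy psi <= #|X|%:R.
Proof. by rewrite ent_entropyE; apply: vnent_le; exact: psd_gram. Qed.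

(** Any finite index type is allowed, so that sign patterns and dependent pairs can label the
    members of an ensemble. *)
Definition decomposition (T I : finType) (rho : op R T) (p : I -> R) (psi : I -> ket R T) :=
  [/\ forall i, 0 <= p i,
      \sum_i p i = 1,
      forall i, unit_ket (psi i) &
      rho = \sum_i (p i)%:C *: ketbra (psi i)].

Definition EOA_values (X Y : finType) (rho : op R (X * Y)%type) : set R :=
  fun e => exists (m : nat) (p : 'I_m -> R) (psi : 'I_m -> ket R (X * Y)%type),
    pure_decomposition rho p psi /\ e = \sum_(i < m) p i * entanglement_entropy (psi i).

Lemma EOA_ubound (X Y : finType) (rho : op R (X * Y)%type) :
  ubound (EOA_values rho) #|X|%:R.
Proof.
move=> e [m [p [psi [[p0 p1 _ _] ->]]]].
have -> : #|X|%:R = \sum_i p i * #|X|%:R by rewrite -mulr_suml p1 mul1r.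
apply: ler_sum => i _.
by apply: ler_wpM2l => //; exact: ent_entropy_le.
Qed.

Lemma EOA_ge (X Y I : finType) (rho : op R (X * Y)%type) (p : I -> R) psi :
  decomposition rho p psi -> \sum_i p i * entanglement_entropy (psi i) <= EOA rho.
Proof.
move=> [p0 p1 upsi ->]; apply: ub_le_sup.
  by exists #|X|%:R; exact: EOA_ubound.
exists #|I|, (p \o enum_val), (psi \o enum_val); split; last by rewrite sum_enum_val.
split; [by move=> i; exact: p0|by rewrite -p1 [RHS]sum_enum_val|by move=> i; exact: upsi|].
by rewrite sum_enum_val.
Qed.

Lemma EOA_le (X Y : finType) (rho : op R (X * Y)%type) b :
    (exists m (p : 'I_m -> R) psi, pure_decomposition rho p psi) ->
    (forall m (p : 'I_m -> R) psi, pure_decomposition rho p psi ->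
       \sum_i p i * entanglement_entropy (psi i) <= b) ->
  EOA rho <= b.
Proof.
move=> [m [p [psi h]]] hb; apply: ge_sup.
  by exists (\sum_i p i * entanglement_entropy (psi i)), m, p, psi.
by move=> e [m' [p' [psi' [h' ->]]]]; exact: hb.
Qed.

Lemma retr_density (T : finType) (rho : op R T) : density rho -> retr rho = 1.
Proof. by move=> [_ h]; rewrite unlock h. Qed.

Section Spectral.
Variables (T : finType) (rho : op R T).
Hypothesis hrho : density rho.

Definition eigenket (k : 'I_#|T|) : ket R T := col k ((spectralmx rho)^t*).

Let U := spectralmx rho.

Lemma eigenket_entry k i j : eigenket k i j = conjc (U k i).
Proof. by rewrite mxE adjmx_entry. Qed.

Lemma sum_eigenket (x : 'I_#|T| -> R) :
  \sum_k (x k)%:C *: eigenket k = U^t* *m (\col_k (x k)%:C).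
Proof.
apply/matrixP => i j; rewrite summxE mulmx_entry; apply: eq_bigr => k _.
by rewrite mxE eigenket_entry adjmx_entry [X in _ = _ * X]mxE mulrC.
Qed.

Lemma unit_sum_eigenket (x : 'I_#|T| -> R) : \sum_k x k ^+ 2 = 1 ->
  unit_ket (\sum_k (x k)%:C *: eigenket k).
Proof.
move=> hx; rewrite /unit_ket sum_eigenket adjmxM trmxCK.
rewrite -mulmxA (mulmxA U) (spectral_unitary rho).1 mul1mx.
apply/matrixP => i j; rewrite !ord1 adj_mulmxE mxE -[RHS]/((1 : R)%:C) -hx.
congr (_%:C); apply: eq_bigr => k _.
by rewrite mxE /sqmod /= expr0n addr0.
Qed.

Lemma unit_eigenket k : unit_ket (eigenket k).
Proof.
have -> : eigenket k = \sum_l ((l == k)%:R)%:C *: eigenket l.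
  rewrite (bigD1 k) //= big1 ?addr0 ?eqxx ?scale1r // => l lk.
  by rewrite (negbTE lk) scale0r.
apply: unit_sum_eigenket; rewrite (bigD1 k) //= big1 ?addr0 ?eqxx ?expr1n // => l lk.
by rewrite (negbTE lk) expr0n.
Qed.

Lemma eigenval_ge0 k : 0 <= eigenval rho 0 k.
Proof. by apply: psd_eigenval; case: hrho. Qed.

Lemma sum_eigenval : \sum_k eigenval rho 0 k = 1.
Proof. by rewrite -(retr_density hrho) retr_eigenval //; case: hrho. Qed.

Lemma eigenket_decomposition : decomposition rho (fun k => eigenval rho 0 k) eigenket.
Proof.
split; [exact: eigenval_ge0|exact: sum_eigenval|exact: unit_eigenket|].
rewrite {1}(spectral_psd hrho.1); apply/matrixP => i j.
rewrite summxE mulmx_entry; apply: eq_bigr => k _.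
rewrite /rdiag mul_mx_diag [in LHS]mxE adjmx_entry map_mxE.
rewrite [in RHS]mxE mulmx_entry big_ord1 adjmx_entry !eigenket_entry conjcK mulrA.
by congr (_ * _); exact: mulrC.
Qed.

Lemma density_decomposition :
  exists m (p : 'I_m -> R) psi, pure_decomposition rho p psi.
Proof.
by exists #|T|, (fun k => eigenval rho 0 k), eigenket; exact: eigenket_decomposition.
Qed.

Definition sign_ket (e : {ffun 'I_#|T| -> bool}) : ket R T :=
  signed (fun k => (Num.sqrt (eigenval rho 0 k))%:C *: eigenket k) e.

(** The squared coefficients are eigenvalues, which sum to 1, so each ket is a unit vector;
    averaging over signs removes the cross terms and leaves the spectral decomposition. *)
Lemma sign_ket_decomposition :
  decomposition rho (fun=> signweight R 'I_#|T|) sign_ket.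
Proof.
split; [by move=> _; exact: signweight_ge0|exact: signweight_sum| |].
  move=> e; rewrite /sign_ket /signed.
  under eq_bigr do rewrite scalerA -rmorphM.
  apply: unit_sum_eigenket; rewrite -sum_eigenval; apply: eq_bigr => k _.
  by rewrite exprMn sqr_sqrtr ?eigenval_ge0 // expr2 sgn_mul mul1r.
rewrite /ketbra; under eq_bigr do rewrite adj_signed.
rewrite average_signed; case: eigenket_decomposition => _ _ _ {1}->.
apply: eq_bigr => k _; rewrite adjmxZ -scalemxAl -scalemxAr scalerA -rmorphM.
by rewrite -expr2 sqr_sqrtr ?eigenval_ge0.
Qed.

End Spectral.

(* Half of the mutual information is reached by one of two decompositions: the
   spectral one, or the one into sign superpositions of eigenvectors. *)
Theorem EOA_ge_half_info (X Y : finType) (rho : op R (X * Y)%type) : density rho ->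
  vnent (partial_trace_snd rho) + vnent (ptr_fst_tr rho) - vnent rho <= 2 * EOA rho.
Proof.
move=> hrho; have dZ := eigenket_decomposition hrho.
have := EOA_ge dZ; have := EOA_ge (sign_ket_decomposition hrho).
pose l k := eigenval rho 0 k; pose e := eigenket rho.
pose W k := (Num.sqrt (l k))%:C *: coefmx (e k).
have l0 k : 0 <= l k by exact: eigenval_ge0.
have WW k : W k *m (W k)^t* = (l k)%:C *: (coefmx (e k) *m (coefmx (e k))^t*).
  by rewrite adjmxZ -scalemxAl -scalemxAr scalerA -rmorphM -expr2 sqr_sqrtr.
have := vnent_tradeoff W.
have -> : \sum_k W k *m (W k)^t* = partial_trace_snd rho.
  case: dZ => _ _ _ def_rho; rewrite [in RHS]def_rho ptr_snd_sum; apply: eq_bigr => k _.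
  by rewrite ptr_snd_ketbra WW.
have -> : \sum_k (W k)^t* *m W k = ptr_fst_tr rho.
  case: dZ => _ _ _ def_rho; rewrite [in RHS]def_rho ptr_fst_tr_sum; apply: eq_bigr => k _.
  rewrite ptr_fst_tr_ketbra adjmxZ -scalemxAl -scalemxAr scalerA -rmorphM.
  by rewrite -expr2 sqr_sqrtr.
have -> : \sum_k vnent (W k *m (W k)^t*) =
    \sum_k l k * entanglement_entropy (e k) + vnent rho.
  rewrite vnent_psd; last by case: hrho.
  rewrite -sumrN -big_split; apply: eq_bigr => k _.
  (* Scaling by [l k] contributes [- l k * ln (l k)]; these terms add up to the entropy of [rho]. *)
  rewrite WW vnent_scale //; last exact: psd_gram.
  by rewrite retr_coefmx ?mulr1 ?ent_entropyE //; exact: unit_eigenket.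
have eE x : vnent (signed W x *m (signed W x)^t*) = entanglement_entropy (sign_ket rho x).
  rewrite ent_entropyE; suff -> : signed W x = coefmx (sign_ket rho x) by [].
  by rewrite coefmx_sum; apply: eq_bigr => k _; rewrite coefmxZ.
rewrite (eq_bigr _ (fun x _ => congr1 ( *%R _) (eE x))).
have comb (a b c x y E : R) : a + b <= x + c + y -> y <= E -> x <= E -> a + b - c <= 2 * E.
  by lra.
exact: comb.
Qed.

(** Decompositions of the [rho i] within [d] of their suprema are concatenated into one of the
    mixture, for every [d > 0]. *)
Theorem EOA_concave (X Y I : finType) (p : I -> R) (rho : I -> op R (X * Y)%type) :
    (forall i, 0 <= p i) -> \sum_i p i = 1 -> (forall i, density (rho i)) ->
  \sum_i p i * EOA (rho i) <= EOA (\sum_i (p i)%:C *: rho i).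
Proof.
move=> p0 p1 hrho; apply/ler_addgt0Pr => d d0.
have h i : exists x : {m : nat & (('I_m -> R) * ('I_m -> ket R (X * Y)%type))%type},
    pure_decomposition (rho i) (projT2 x).1 (projT2 x).2 /\
    EOA (rho i) - d < \sum_j (projT2 x).1 j * entanglement_entropy ((projT2 x).2 j).
  have hs : has_sup (EOA_values (rho i)).
    split; last by exists #|X|%:R; exact: EOA_ubound.
    have [m [q [psi hd]]] := density_decomposition (hrho i).
    by exists (\sum_j q j * entanglement_entropy (psi j)), m, q, psi.
  have [e [m [q [psi [hd ->]]]] he] := sup_adherent d0 hs.
  by exists (existT _ m (q, psi)).
have /choice[x hx] := h.
(* Dependent pairs, because the chosen decompositions have different lengths. *)
pose J := {i : I & 'I_(projT1 (x i))}.
pose q (j : J) := p (tag j) * (projT2 (x (tag j))).1 (tagged j).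
pose psi (j : J) := (projT2 (x (tag j))).2 (tagged j).
have sumJ (V : nmodType) (F : forall i, 'I_(projT1 (x i)) -> V) :
    \sum_(j : J) F (tag j) (tagged j) = \sum_i \sum_j F i j.
  by rewrite sig_big_dep.
have dec : decomposition (\sum_i (p i)%:C *: rho i) q psi.
  split.
  - by move=> [i j]; rewrite mulr_ge0 //; have [[]] := hx i.
  - rewrite (sumJ _ (fun i j => p i * (projT2 (x i)).1 j)) -p1; apply: eq_bigr => i _.
    by rewrite -mulr_sumr; have [[_ -> _ _] _] := hx i; rewrite mulr1.
  - by move=> [i j]; have [[_ _ u _] _] := hx i; exact: u.
  - rewrite (sumJ _ (fun i j => (p i * (projT2 (x i)).1 j)%:C *: ketbra ((projT2 (x i)).2 j))).
    apply: eq_bigr => i _; have [[_ _ _ def_i] _] := hx i.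
    by rewrite [in LHS]def_i scaler_sumr; apply: eq_bigr => j _; rewrite scalerA rmorphM.
rewrite -lerBlDr; apply: le_trans (EOA_ge dec).
rewrite (sumJ _ (fun i j => p i * (projT2 (x i)).1 j * entanglement_entropy ((projT2 (x i)).2 j))).
rewrite -[d]mul1r -p1 mulr_suml -sumrB; apply: ler_sum => i _.
rewrite -mulrBr; under [leRHS]eq_bigr do rewrite -mulrA.
by rewrite -mulr_sumr ler_wpM2l // ltW //; have [_] := hx i.
Qed.

End Assistance.
(** * Polygamy *)

Section Polygamy.
Variable R : realType.
Local Notation C := R[i].

Lemma EOA_ge0 (X Y : finType) (rho : op R (X * Y)%type) : 0 <= EOA rho.
Proof.
have [[e he]|h] := pselect (exists e, EOA_values rho e).
  have [m [p [psi [[p0 p1 u _] def_e]]]] := he.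
  apply: (@le_trans _ _ e).
    by rewrite def_e; apply: sumr_ge0 => i _; rewrite mulr_ge0 ?ent_entropy_ge0.
  by apply: ub_le_sup => //; exists #|X|%:R; exact: EOA_ubound.
(* Without any decomposition the supremum is that of the empty set, 0 by default. *)
suff -> : EOA rho = 0 by [].
by apply: sup_out => -[[e he] _]; apply: h; exists e.
Qed.

Section Marginal.
Variables (A F B K : finType) (pi : F -> B) (kap : F -> K).

(* When [f |-> (pi f, kap f)] is injective, it embeds the space labelled by [F]
   into the tensor product of the spaces labelled by [B] and [K], and
   [marginal rho] traces out the factor [K]. *)
Definition marginal (rho : op R (A * F)%type) : op R (A * B)%type :=
  op_of_fun (fun x y : A * B => \sum_(f | pi f == x.2)
    \sum_(g | (pi g == y.2) && (kap g == kap f)) op_entry rho (x.1, f) (y.1, g)).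

Lemma marginalE (rho : op R (A * F)%type) x y : op_entry (marginal rho) x y =
  \sum_(f | pi f == x.2)
    \sum_(g | (pi g == y.2) && (kap g == kap f)) op_entry rho (x.1, f) (y.1, g).
Proof. exact: op_of_funE. Qed.

Lemma marginal_sum (I : finType) (p : I -> R) (M : I -> op R (A * F)%type) :
  marginal (\sum_i (p i)%:C *: M i) = \sum_i (p i)%:C *: marginal (M i).
Proof.
apply/op_entryP => x y; rewrite op_entry_sum op_of_funE.
under eq_bigr do under eq_bigr do rewrite op_entry_sum.
under eq_bigr do rewrite exchange_big.
rewrite exchange_big; apply: eq_bigr => i _; rewrite op_of_funE mulr_sumr.
by apply: eq_bigr => f _; rewrite mulr_sumr.
Qed.

(** The amplitudes of [psi] seen as a ket on A B K, arranged for the cut between A B and K. *)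
Definition tripartite (psi : ket R (A * F)%type) : 'M[C]_(#|{: A * B}|, #|K|) :=
  \matrix_(i, k) \sum_(f | (pi f == (enum_val i).2) && (kap f == enum_val k))
    ket_at psi ((enum_val i).1, f).

Lemma tripartiteE (psi : ket R (A * F)%type) i k : tripartite psi i k =
  \sum_(f | (pi f == (enum_val i).2) && (kap f == enum_val k))
    ket_at psi ((enum_val i).1, f).
Proof. by rewrite mxE. Qed.

Lemma marginal_ketbra (psi : ket R (A * F)%type) :
  marginal (ketbra psi) = tripartite psi *m (tripartite psi)^t*.
Proof.
apply/matrixP => i j; rewrite mxE mulmx_entry.
rewrite (partition_big kap predT) //= sum_enum_val; apply: eq_bigr => k _.
rewrite adjmx_entry !tripartiteE mulr_suml; apply: eq_bigr => f /andP[_ /eqP kf].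
rewrite rmorph_sum mulr_sumr kf; apply: eq_bigr => g _.
exact: op_entry_ketbra.
Qed.

Lemma ptr_snd_marginal (rho : op R (A * F)%type) :
    (forall f g, pi f = pi g -> kap f = kap g -> f = g) ->
  partial_trace_snd (marginal rho) = partial_trace_snd rho.
Proof.
move=> inj; apply/op_entryP => a a'; rewrite !op_of_funE.
rewrite [RHS](partition_big pi predT) //=; apply: eq_bigr => b _.
rewrite op_of_funE /=; apply: eq_bigr => f /eqP pf.
rewrite (big_pred1 f) // => g; apply/andP/eqP => [[/eqP pg /eqP kg]|->].
  by apply: inj => //; rewrite pg.
by rewrite pf !eqxx.
Qed.

End Marginal.

(** The reduced operator on K is thus the other Gram matrix of the matrix that gives the state of A
    B, so the two have equal entropy. *)
Lemma ptr_fst_tr_marginal (A F B K : finType) (pi : F -> B) (kap : F -> K)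
    (psi : ket R (A * F)%type) :
  ptr_fst_tr (marginal kap pi (ketbra psi)) =
    (tripartite pi kap psi)^t* *m tripartite pi kap psi.
Proof.
apply/matrixP => i j; rewrite mxE mulmx_entry.
transitivity (\sum_(x : A * B)
   conjc (\sum_(g | (pi g == x.2) && (kap g == enum_val i)) ket_at psi (x.1, g)) *
   \sum_(f | (pi f == x.2) && (kap f == enum_val j)) ket_at psi (x.1, f)); last first.
  rewrite sum_enum_val; apply: eq_bigr => k _.
  by rewrite adjmx_entry !tripartiteE.
rewrite -(pair_bigA _ (fun a b =>
   conjc (\sum_(g | (pi g == b) && (kap g == enum_val i)) ket_at psi (a, g)) *
   \sum_(f | (pi f == b) && (kap f == enum_val j)) ket_at psi (a, f))) /=.
apply: eq_bigr => a _; rewrite op_of_funE /=.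
rewrite (partition_big pi predT) //=; apply: eq_bigr => b _.
rewrite mulr_sumr (eq_bigl (fun f => (pi f == b) && (kap f == enum_val j))); last first.
  by move=> f; rewrite andbC.
apply: eq_bigr => f /andP[/eqP pf _].
rewrite rmorph_sum mulr_suml pf (eq_bigl (fun g => (pi g == b) && (kap g == enum_val i))); last first.
  by move=> g; rewrite andbC.
by apply: eq_bigr => g _; rewrite op_entry_ketbra mulrC.
Qed.

Lemma tr_gram m n (W : 'M[C]_(m, n)) : \tr (W *m W^t*) = (retr (W *m W^t*))%:C.
Proof.
rewrite retr.unlock {2}/mxtrace Re_sum rmorph_sum; apply: eq_bigr => i _.
by rewrite mulmx_adjE.
Qed.

Lemma tr_ptr_snd (X Y : finType) (rho : op R (X * Y)%type) :
  \tr (partial_trace_snd rho) = \tr rho.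
Proof.
rewrite /mxtrace (sum_enum_rank (fun i => rho i i)).
transitivity (\sum_(x : X) \sum_(y : Y) op_entry rho (x, y) (x, y)); last first.
  by rewrite pair_bigA; apply: eq_bigr => -[].
by rewrite [RHS]sum_enum_val; apply: eq_bigr => i _; rewrite mxE.
Qed.

Lemma density_marginal_ketbra (A F B K : finType) (pi : F -> B) (kap : F -> K)
    (psi : ket R (A * F)%type) :
    (forall f g, pi f = pi g -> kap f = kap g -> f = g) -> unit_ket psi ->
  density (marginal pi kap (ketbra psi)).
Proof.
move=> inj upsi; split; first by rewrite marginal_ketbra; exact: psd_gram.
by rewrite -tr_ptr_snd ptr_snd_marginal // ptr_snd_ketbra tr_gram retr_coefmx.
Qed.

Lemma density_mixture (T I : finType) (p : I -> R) (M : I -> op R T) :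
    (forall i, 0 <= p i) -> \sum_i p i = 1 -> (forall i, density (M i)) ->
  density (\sum_i (p i)%:C *: M i).
Proof.
move=> p0 p1 hM; split; first by apply: psd_sum => // i; case: (hM i).
rewrite raddf_sum -[RHS]/((1 : R)%:C) -p1 rmorph_sum; apply: eq_bigr => i _.
apply: (etrans (mxtraceZ _ _)).
by case: (hM i) => _ ->; rewrite mulr1.
Qed.

Lemma density_marginal (A F B K : finType) (pi : F -> B) (kap : F -> K)
    (rho : op R (A * F)%type) :
    (forall f g, pi f = pi g -> kap f = kap g -> f = g) -> density rho ->
  density (marginal pi kap rho).
Proof.
move=> inj /eigenket_decomposition[p0 p1 u ->]; rewrite marginal_sum.
by apply: density_mixture => // i; apply: density_marginal_ketbra.
Qed.

Lemma ent_entropy_polygamy (A F B K : finType) (pi : F -> B) (kap : F -> K)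
    (psi : ket R (A * F)%type) :
    (forall f g, pi f = pi g -> kap f = kap g -> f = g) -> unit_ket psi ->
  entanglement_entropy psi <=
    EOA (marginal pi kap (ketbra psi)) + EOA (marginal kap pi (ketbra psi)).
Proof.
move=> inj upsi; have inj' f g : kap f = kap g -> pi f = pi g -> f = g.
  by move=> kfg pfg; exact: inj.
have := EOA_ge_half_info (density_marginal_ketbra inj upsi).
have := EOA_ge_half_info (density_marginal_ketbra inj' upsi).
(* The entropies of K and A B become one term, those of B and A K another, and both cancel when the
   two inequalities are added. *)
rewrite !ptr_snd_marginal // ptr_snd_ketbra -ent_entropyE !ptr_fst_tr_marginal.
rewrite !marginal_ketbra !vnent_gramC.
have comb (a x y u v : R) : a + x - y <= 2 * u -> a + y - x <= 2 * v -> a <= v + u by lra.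
exact: comb.
Qed.

(** The pure-state bound is averaged over a decomposition of [rho], and concavity bounds each
    average by the assistance of the mixed marginal. *)
Lemma EOA_polygamy (A F B K : finType) (pi : F -> B) (kap : F -> K)
    (rho : op R (A * F)%type) :
    (forall f g, pi f = pi g -> kap f = kap g -> f = g) -> density rho ->
  EOA rho <= EOA (marginal pi kap rho) + EOA (marginal kap pi rho).
Proof.
move=> inj /density_decomposition hrho; apply: EOA_le => // m p psi [p0 p1 u ->].
have inj' f g : kap f = kap g -> pi f = pi g -> f = g.
  by move=> kfg pfg; exact: inj.
rewrite !marginal_sum.
apply: (@le_trans _ _ (\sum_i p i * EOA (marginal pi kap (ketbra (psi i)))
                       + \sum_i p i * EOA (marginal kap pi (ketbra (psi i))))).
  rewrite -big_split; apply: ler_sum => i _; rewrite /= -mulrDr.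
  by apply: ler_wpM2l => //; exact: ent_entropy_polygamy.
by apply: lerD; apply: EOA_concave => // i; apply: density_marginal_ketbra.
Qed.

(** The second system has dimension at most one, so the Gram matrix on its side is the identity,
    whose logarithm is 0. *)
Lemma EOA_trivial (A F : finType) (rho : op R (A * F)%type) :
  (forall f g : F, f = g) -> density rho -> EOA rho <= 0.
Proof.
move=> hF /density_decomposition hrho; apply: EOA_le => // m p psi [_ _ u _].
rewrite le_eqVlt; apply/orP; left; apply/eqP; apply: big1 => i _.
rewrite ent_entropyE vnent_gramC; set W := coefmx (psi i).
suff -> : W^t* *m W = 1%:M.
  rewrite /vnent mxfun1 ln1 mul1mx (_ : (0 : R)%:C%:M = 0) ?raddf0 //.
  by rewrite retr.unlock mxtrace0 /= oppr0 mulr0.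
have eqI (j l : 'I_#|F|) : j = l by apply: enum_val_inj; exact: hF.
apply/matrixP => j l; rewrite (eqI l j) adj_mulmxE [RHS]mxE eqxx.
rewrite -[RHS]/((1 : R)%:C) -(retr_coefmx (u i)); congr (_%:C).
rewrite -/W retrC retr.unlock /mxtrace Re_sum (bigD1 j) //= [X in _ + X]big1 => [|l' l'j].
  by rewrite addr0 adj_mulmxE.
by rewrite (eqI l' j) eqxx in l'j.
Qed.

(** * Induction over the parties *)

Section Multipartite.
Variables (A : finType) (N : nat) (B : 'I_N -> finType).

(** A form of [reduced_AB] for the parties in [S] whose labels are read off an abstract type [F];
    unlike dependent functions, such types are preserved when a party is removed. *)
Definition local_marginal (F : finType) (pi : forall i, F -> B i) (S : {set 'I_N})
    (j : 'I_N) (rho : op R (A * F)%type) : op R (A * B j)%type :=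
  op_of_fun (fun x y : A * B j => \sum_(f | pi j f == x.2)
    \sum_(g | (pi j g == y.2) && [forall (i | (i \in S) && (i != j)), pi i g == pi i f])
      op_entry rho (x.1, f) (y.1, g)).

Section Quotient.
Variables (F : finType) (pi : forall i, F -> B i) (S : {set 'I_N}).

Definition same (f g : F) := [forall (i | i \in S), pi i f == pi i g].

Lemma sameP f g : reflect (forall i, i \in S -> pi i f = pi i g) (same f g).
Proof.
apply: (iffP forall_inP) => h i iS; first exact/eqP/h.
by apply/eqP/h.
Qed.

Definition repr_same (f : F) : F := odflt f [pick g | same f g].

Lemma repr_sameE f i : i \in S -> pi i (repr_same f) = pi i f.
Proof.
rewrite /repr_same; case: pickP => [g /sameP h|_] iS //=.
by rewrite -h.
Qed.

(** Equivalent labels define the same predicate [same], so [pick] selects the same element for both;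
    its default is never reached, by reflexivity. *)
Lemma repr_same_eq f g : (repr_same f == repr_same g) = same f g.
Proof.
apply/eqP/sameP => [h i iS|h]; first by rewrite -repr_sameE // h repr_sameE.
rewrite /repr_same (eq_pick (Q := same g)) => [|x].
  by case: pickP => // /(_ g); rewrite (introT (sameP g g)).
by apply/sameP/sameP => h' i iS; rewrite -h' // h.
Qed.

Lemma repr_sameK f : repr_same (repr_same f) == repr_same f.
Proof. by rewrite repr_same_eq; apply/sameP => i; exact: repr_sameE. Qed.

(** The joint labels of the parties in [S], as canonical representatives inside [F]. *)
Definition quot := {f : F | repr_same f == f}.

Definition to_quot (f : F) : quot := exist _ (repr_same f) (repr_sameK f).

Lemma to_quot_eq f g : (to_quot f == to_quot g) = same f g.
Proof. by rewrite -val_eqE /= repr_same_eq. Qed.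

End Quotient.

(** Induction on the size of [S]: one party [j0] is split off from the joint system of the others,
    whose labels are classes modulo agreement on [S']. *)
Theorem EOA_polygamy_set (F : finType) (pi : forall i, F -> B i) (S : {set 'I_N})
    (rho : op R (A * F)%type) :
    (forall f g, (forall i, i \in S -> pi i f = pi i g) -> f = g) -> density rho ->
  EOA rho <= \sum_(j in S) EOA (local_marginal pi S j rho).
Proof.
have [n] := ubnP #|S|; elim: n => // n IH in F pi S rho *; rewrite ltnS => Sn inj hrho.
have [S0|[j0 j0S]] := set_0Vmem S.
  rewrite S0 big_set0; apply: EOA_trivial => // f g; apply: inj => i.
  by rewrite S0 inE.
pose S' := S :\ j0; pose kap := to_quot pi S'.
pose pi' i (f : quot pi S') := pi i (val f).
have kapE f g : (kap f == kap g) = same pi S' f g by exact: to_quot_eq.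
have inj2 f g : pi j0 f = pi j0 g -> kap f = kap g -> f = g.
  move=> e0 /eqP; rewrite kapE => /sameP e; apply: inj => i iS.
  by have [->//|ij0] := eqVneq i j0; apply: e; rewrite !inE ij0.
have inj2' f g : kap f = kap g -> pi j0 f = pi j0 g -> f = g.
  by move=> ? ?; exact: inj2.
rewrite (big_setD1 j0) //=; apply: le_trans (EOA_polygamy inj2 hrho) _.
have -> : marginal (pi j0) kap rho = local_marginal pi S j0 rho.
  apply/op_entryP => x y; rewrite !op_of_funE; apply: eq_bigr => f _.
  apply: eq_bigl => g; rewrite kapE; congr (_ && _); apply: eq_forallb => i.
  by rewrite !inE andbC.
rewrite lerD2l; apply: le_trans (IH _ pi' S' _ _ _ (density_marginal inj2' hrho)) _.
- by move: Sn; rewrite (cardsD1 j0) j0S.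
- move=> f g h; apply: val_inj; rewrite -(eqP (valP f)) -(eqP (valP g)).
  by apply/eqP; rewrite repr_same_eq; apply/sameP.
(* Tracing out [j0] and then the parties of [S'] other than [j] equals tracing out all of [S] but
   [j] at once; both sums are grouped by classes of labels. *)
apply: ler_sum => j jS'; rewrite (_ : local_marginal _ _ _ _ = local_marginal pi S j rho) //.
have /andP[jj0 jS] : (j != j0) && (j \in S) by move: jS'; rewrite !inE.
have pikap i f : i \in S' -> pi' i (kap f) = pi i f by exact: repr_sameE.
apply/op_entryP => x y; rewrite !op_of_funE.
rewrite [RHS](partition_big kap (fun f' => pi' j f' == x.2)) => [|f]; last by rewrite pikap.
apply: eq_bigr => f' /eqP pf'.
apply: (etrans (eq_bigr _ (fun g _ => marginalE kap (pi j0) rho _ _))).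
rewrite exchange_big /= (eq_bigl (fun f => (pi j f == x.2) && (kap f == f'))); last first.
  move=> f; case: eqP => [kf|]; last by rewrite andbF.
  by rewrite -pf' -kf pikap // eqxx.
apply: eq_bigr => f /andP[_ /eqP kf].
pose P' g' := (pi' j g' == y.2) && [forall (i | (i \in S') && (i != j)), pi' i g' == pi' i f'].
rewrite [RHS](partition_big kap P') => [|g /andP[pg /forall_inP h]]; last first.
  rewrite /P' pikap // pg; apply/forall_inP => i /andP[iS' ij].
  rewrite -kf !pikap // h // ij andbT.
  by move: iS'; rewrite !inE => /andP[].
apply: eq_bigr => g' /andP[pg' /forall_inP hg']; apply: eq_bigl => g.
have [kg|] := eqVneq (kap g) g'; last by rewrite andbF.
rewrite andbT /= -(pikap j) // kg pg' /=.
apply/eqP/forall_inP => [e0 i /andP[iS ij]|h].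
  have [->|ij0] := eqVneq i j0; first by rewrite e0.
  have iS' : i \in S' by rewrite !inE ij0.
  by rewrite -(pikap i g) // -(pikap i f) // kg kf hg' // iS'.
by apply/eqP/h; rewrite j0S eq_sym.
Qed.

Corollary EOA_polygamy_sum (rho : op R (A * {dffun forall i : 'I_N, B i})%type) :
  density rho -> EOA rho <= \sum_j EOA (reduced_AB rho j).
Proof.
move=> hrho; pose pi i (f : {dffun forall i : 'I_N, B i}) := f i.
apply: le_trans (@EOA_polygamy_set _ pi [set: 'I_N] rho _ hrho) _.
  by move=> f g h; apply/ffunP => i; apply: h; rewrite inE.
under eq_bigl => j do rewrite finset.in_setT.
apply: ler_sum => j _; rewrite (_ : local_marginal _ _ _ _ = reduced_AB rho j) //.
apply/op_entryP => x y; rewrite !op_of_funE; apply: eq_bigr => f _.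
apply: eq_bigl => g; congr (_ && _); apply: eq_forallb => i.
by rewrite inE.
Qed.

End Multipartite.
End Polygamy.
(** * Powers and Hamming weights *)

Section Powers.
Variable R : realType.

(** With [x = ln s], the bound [1 + u <= expR u] is used at [(1 - b) * x] and [- (b * x)]; weighting
    by [b] and [1 - b] cancels the terms linear in [x]. *)
Lemma powR_bernoulli (b s : R) : 0 <= b <= 1 -> 0 < s -> s `^ b <= 1 + b * (s - 1).
Proof.
move=> /andP[b0 b1] s0; rewrite /powR gt_eqF //; set x := ln s.
have -> : s = expR x by rewrite lnK // posrE.
have e1 := expR_ge1Dx ((1 - b) * x); have e2 := expR_ge1Dx (- (b * x)).
have h0 := expR_gt0 (b * x).
have f1 : expR x = expR (b * x) * expR ((1 - b) * x) by rewrite -expRD; congr expR; ring.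
have f2 : 1 = expR (b * x) * expR (- (b * x)) by rewrite expRN divff // gt_eqF.
have g1 : expR (b * x) * (1 + (1 - b) * x) <= expR x by rewrite f1 ler_pM2l.
have g2 : expR (b * x) * (1 + - (b * x)) <= 1 by rewrite [leRHS]f2 ler_pM2l.
have k1 := ler_wpM2l b0 g1; have b1' : 0 <= 1 - b by lra.
have k2 := ler_wpM2l b1' g2.
move: (expR (b * x)) (expR x) k1 k2 => u v k1 k2; lra.
Qed.

Lemma powR_tangent (b m u : R) : 0 <= b <= 1 -> 0 < m -> 0 < u ->
  u `^ b <= m `^ b + m `^ b * b / m * (u - m).
Proof.
move=> hb m0 u0; have := ler_wpM2l (powR_ge0 m b) (powR_bernoulli hb (divr_gt0 u0 m0)).
rewrite -(powRM b (ltW m0) (divr_ge0 (ltW u0) (ltW m0))).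
have -> : m * (u / m) = u by field; rewrite gt_eqF.
move=> /le_trans; apply; rewrite le_eqVlt; apply/orP; left; apply/eqP.
by field; rewrite gt_eqF.
Qed.

Lemma powR_concave (b u v l : R) : 0 <= b <= 1 -> 0 < u -> 0 < v -> 0 <= l <= 1 ->
  l * u `^ b + (1 - l) * v `^ b <= (l * u + (1 - l) * v) `^ b.
Proof.
move=> hb u0 v0 /andP[l0 l1]; set m := _ + _ * v.
have m0 : 0 < m.
  have : 0 <= l * u by rewrite mulr_ge0 // ltW.
  have : 0 <= (1 - l) * v by rewrite mulr_ge0 ?subr_ge0 // ltW.
  rewrite /m; have [l_0|l_0] := eqVneq l 0; first by rewrite l_0; nra.
  have : 0 < l * u by rewrite mulr_gt0 // lt_def l_0.
  by move=> ? ? ?; lra.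
have hu := ler_wpM2l l0 (powR_tangent hb m0 u0).
have l1' : 0 <= 1 - l by lra.
have hv := ler_wpM2l l1' (powR_tangent hb m0 v0).
apply: (le_trans (lerD hu hv)); rewrite le_eqVlt; apply/orP; left; apply/eqP.
move: (m `^ b * b / m) => d; rewrite {2 4}/m; ring.
Qed.

Lemma powR_increment (b h x y : R) : 0 <= b <= 1 -> 0 < h -> 0 < x -> x <= y ->
  (y + h) `^ b + x `^ b <= y `^ b + (x + h) `^ b.
Proof.
move=> hb h0 x0 xy; have y0 := lt_le_trans x0 xy.
(* The points [y] and [x + h] are convex combinations of [x] and [y + h] with complementary weights,
   so the two concavity inequalities add up to the claim. *)
pose l := h / (y + h - x); have d0 : 0 < y + h - x by lra.
have l01 : 0 <= l <= 1.
  by rewrite divr_ge0 ?(ltW h0) ?(ltW d0) //= ler_pdivrMr // mul1r; lra.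
have l01' : 0 <= 1 - l <= 1 by move: l01 => /andP[? ?]; lra.
have yh0 : 0 < y + h by lra.
have h1 := powR_concave hb x0 yh0 l01; have h2 := powR_concave hb x0 yh0 l01'.
have e1 : l * x + (1 - l) * (y + h) = y by rewrite /l; field; rewrite gt_eqF.
have e2 : (1 - l) * x + (1 - (1 - l)) * (y + h) = x + h by rewrite /l; field; rewrite gt_eqF.
rewrite e1 in h1; rewrite e2 in h2.
move: (x `^ b) ((y + h) `^ b) (y `^ b) ((x + h) `^ b) h1 h2 => p q r s h1 h2; lra.
Qed.

Section Weight.
Variables (b k : R).
Hypotheses (hb : 0 <= b <= 1) (hk : 0 < k <= 1).

(** The constant that makes [powRD_le] an equality at [y = k * x]. *)
Definition weight := ((1 + k) `^ b - 1) / k `^ b.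

Let k0 : 0 < k. Proof. by case/andP: hk. Qed.
Let b0 : 0 <= b. Proof. by case/andP: hb. Qed.

Lemma weight_ge0 : 0 <= weight.
Proof.
rewrite divr_ge0 ?powR_ge0 // subr_ge0.
have e1 : (1 : R) `^ b = 1 by rewrite powR1.
rewrite -[leLHS]e1; apply: ge0_ler_powR => //; rewrite ?nnegrE ?lerDl ?ler01 ?(ltW k0) //.
by rewrite addr_ge0 // ltW.
Qed.

(** After scaling, [y = t * (k * x)] with [t <= 1]. The increment of the power over a step [t * k]
    is smaller from 1 than from [t], where it equals [t ^ b * ((1 + k) ^ b - 1)]. *)
Lemma powRD_le x y : 0 <= x -> 0 <= y -> y <= k * x ->
  (x + y) `^ b <= x `^ b + weight * y `^ b.
Proof.
rewrite le_eqVlt => /predU1P[<-|x0]; rewrite le_eqVlt => /predU1P[<-|y0] hxy.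
- by rewrite addr0 lerDl mulr_ge0 ?weight_ge0 ?powR_ge0.
- by move: hxy; rewrite mulr0 leNgt y0.
- by rewrite addr0 lerDl mulr_ge0 ?weight_ge0 ?powR_ge0.
have kx0 : 0 < k * x by rewrite mulr_gt0.
pose t := y / (k * x); have t0 : 0 < t by rewrite divr_gt0.
have t1 : t <= 1 by rewrite ler_pdivrMr // mul1r.
have ey : y = t * (k * x) by rewrite /t; field; rewrite !gt_eqF.
have -> : x + y = x * (1 + t * k) by rewrite ey; ring.
have := powR_increment hb (mulr_gt0 t0 k0) t0 t1.
rewrite powR1 (_ : t + t * k = t * (1 + k)); last by ring.
have k10 : 0 <= 1 + k by rewrite addr_ge0 ?ltW.
have tk10 : 0 <= 1 + t * k by rewrite addr_ge0 // mulr_ge0 // ltW.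
rewrite (powRM _ (ltW t0) k10) (powRM _ (ltW x0) tk10) ey.
rewrite (powRM _ (ltW t0) (ltW kx0)) (powRM _ (ltW k0) (ltW x0)) /weight => h.
have kb0 : k `^ b != 0 by rewrite gt_eqF // powR_gt0.
have -> : ((1 + k) `^ b - 1) / k `^ b * (t `^ b * (k `^ b * x `^ b)) =
    x `^ b * (t `^ b * (1 + k) `^ b - t `^ b) by field.
apply: (@le_trans _ _ (x `^ b * (1 + (t `^ b * (1 + k) `^ b - t `^ b)))).
  by apply: ler_wpM2l; [exact: powR_ge0|lra].
by rewrite mulrDr mulr1.
Qed.

Lemma hamming_weight_sum n j : (j < 2 ^ n)%N ->
  hamming_weight j = (\sum_(i < n) odd (j %/ 2 ^ i))%N.
Proof.
move=> jn; rewrite -(hamming_weightE jn) -sum1_count big_tuple big_mkcond /=.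
by apply: eq_bigr => i _; rewrite tnth_mktuple; case: (odd _).
Qed.

Lemma hamming_weight0 : hamming_weight 0 = 0%N.
Proof. by rewrite (@hamming_weight_sum 0) // big_ord0. Qed.

Lemma hamming_weight_add n j : (j < 2 ^ n)%N ->
  hamming_weight (j + 2 ^ n) = (hamming_weight j).+1.
Proof.
move=> jn; rewrite (@hamming_weight_sum n.+1); last by rewrite expnS mul2n -addnn ltn_add2r.
rewrite (hamming_weight_sum jn) big_ord_recr /= divnDr // divnn expn_gt0 /=.
rewrite (divn_small jn) add0n /= addn1; congr _.+1; apply: eq_bigr => i _.
have le_in : (i < n)%N by [].
(* A lower digit is unchanged: its quotient gains [2 ^ (n - i)], which is even. *)
rewrite divnDr ?dvdn_exp2l ?(ltnW le_in) // -expnB ?(ltnW le_in) //.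
by rewrite oddD oddX subn_eq0 leqNgt le_in /= addbF.
Qed.

(** Induction on the number [n] of digits; the indices from [2 ^ n] on have one more digit 1 than
    their remainders. *)
Lemma powR_sum_le n N (x : nat -> R) : (0 < N)%N -> (N <= 2 ^ n)%N ->
    (forall j, (j < N)%N -> 0 <= x j) ->
    (forall j, (j.+1 < N)%N -> x j.+1 <= k * x j) ->
  (\sum_(0 <= j < N) x j) `^ b <=
    \sum_(0 <= j < N) weight ^+ hamming_weight j * x j `^ b.
Proof.
elim: n N x => [|n IH] N x N0.
  rewrite expn0 => N1 _ _; have -> : N = 1%N by apply/eqP; rewrite eqn_leq N1.
  by rewrite !big_nat1 hamming_weight0 expr0 mul1r.
move=> N2 x0 xk; have [le|gt] := leqP N (2 ^ n); first exact: IH.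
pose M := (N - 2 ^ n)%N.
have defN : N = (M + 2 ^ n)%N by rewrite subnK // ltnW.
have M0 : (0 < M)%N by rewrite subn_gt0.
have M2 : (M <= 2 ^ n)%N by rewrite leq_subLR addnn -mul2n -expnS.
have p0 : (0 < 2 ^ n)%N by rewrite expn_gt0.
have split_sum (F : nat -> R) : \sum_(0 <= j < N) F j =
    \sum_(0 <= j < 2 ^ n) F j + \sum_(0 <= j < M) F (j + 2 ^ n)%N.
  rewrite (big_cat_nat (leq0n (2 ^ n)) (ltnW gt)) /=; congr (_ + _).
  by rewrite -{1}[(2 ^ n)%N]add0n big_addn.
(* Each step gains a factor [k]; as [k <= 1], a single one is kept. *)
have shift j p : (j + p.+1 < N)%N -> x (j + p.+1)%N <= k * x j.
  elim: p => [|p IHp] h; first by rewrite addn1; apply: xk; rewrite -addn1.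
  have h' : (j + p.+1 < N)%N by apply: ltn_trans h; rewrite ltn_add2l.
  have hj : (j < N)%N by apply: leq_ltn_trans h'; rewrite leq_addr.
  rewrite addnS; apply: le_trans (xk _ _) _; first by rewrite -addnS.
  have k1 : k <= 1 by case/andP: hk.
  apply: le_trans (_ : k * (k * x j) <= _); first by rewrite ler_wpM2l ?(ltW k0) ?IHp.
  by rewrite ler_wpM2l ?(ltW k0) // ler_piMl ?x0.
rewrite !split_sum; set X := \sum_(0 <= j < 2 ^ n) x j; set Y := \sum_(0 <= j < M) x _.
have X0 : 0 <= X.
  by rewrite /X big_nat sumr_ge0 // => j /andP[_ hj]; apply: x0; exact: ltn_trans gt.
have hMN j : (j < M)%N -> (j + 2 ^ n < N)%N by move=> hj; rewrite defN ltn_add2r.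
have Y0 : 0 <= Y.
  by rewrite /Y big_nat sumr_ge0 // => j /andP[_ hj]; apply: x0; exact: hMN.
(* Each term of the upper block is compared with the one [2 ^ n] places below; there are
   [M <= 2 ^ n] of them. *)
have YX : Y <= k * X.
  apply: (@le_trans _ _ (k * \sum_(0 <= j < M) x j)).
    rewrite mulr_sumr /Y !big_nat; apply: ler_sum => j /andP[_ hj].
    by rewrite -(prednK p0); apply: shift; rewrite prednK // hMN.
  rewrite ler_wpM2l ?(ltW k0) // /X (big_cat_nat (leq0n M) M2) /= lerDl big_nat sumr_ge0 //.
  by move=> j /andP[_ hj]; apply: x0; exact: ltn_trans gt.
apply: le_trans (powRD_le X0 Y0 YX) _; apply: lerD.
  apply: IH => // j hj; first by apply: x0; exact: ltn_trans gt.
  by apply: xk; exact: ltn_trans gt.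
have -> : \sum_(0 <= j < M) weight ^+ hamming_weight (j + 2 ^ n) * x (j + 2 ^ n)%N `^ b =
    weight * \sum_(0 <= j < M) weight ^+ hamming_weight j * x (j + 2 ^ n)%N `^ b.
  rewrite mulr_sumr !big_nat; apply: eq_bigr => j /andP[_ hj].
  by rewrite hamming_weight_add ?(leq_trans hj) // exprS mulrA.
rewrite ler_wpM2l ?weight_ge0 //; apply: (IH M (fun j => x (j + 2 ^ n)%N)) => // j hj.
  by apply: x0; exact: hMN.
by apply: xk; have := hMN _ hj; rewrite addSn.
Qed.

End Weight.
End Powers.
Theorem theorem1 (R : realType) (beta k : R)
    (hbeta : 0 <= beta <= 1) (hk : 0 < k <= 1)
    (N : nat) (hN : (1 <= N)%N)
    (A : finType) (B : 'I_N -> finType)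
    (rho : op R (A * {dffun forall i : 'I_N, B i})%type)
    (hrho : density rho)
    (hchain : forall i j : 'I_N, nat_of_ord j = i.+1 ->
       EOA (reduced_AB rho j) / k ^+ j <= EOA (reduced_AB rho i) / k ^+ i)
    (hlast : forall j : 'I_N, nat_of_ord j = N.-1 ->
       0 <= EOA (reduced_AB rho j) / k ^+ j) :
  EOA rho `^ beta <=
    \sum_(j < N)
      (((1 + k) `^ beta - 1) / k `^ beta) ^+ hamming_weight j
        * EOA (reduced_AB rho j) `^ beta.
Proof.
have [beta0 _] := andP hbeta; have [k0 _] := andP hk.
(* Extension by 0 to all natural numbers, to allow splitting and shifting the sum. *)
pose x (j : nat) : R :=
  if insub j is Some i then EOA (reduced_AB rho i) else 0.
have xE (i : 'I_N) : x i = EOA (reduced_AB rho i) by rewrite /x valK.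
have x0 j : (j < N)%N -> 0 <= x j.
  by move=> jN; rewrite -[j]/(val (Ordinal jN)) xE; exact: EOA_ge0.
have xk j : (j.+1 < N)%N -> x j.+1 <= k * x j.
  move=> jN; have := hchain (Ordinal (ltnW jN)) (Ordinal jN) erefl.
  rewrite -!xE /= ler_pdivrMr ?exprn_gt0 // => /le_trans; apply.
  rewrite exprSr mulrA divfK; last by rewrite gt_eqF // exprn_gt0.
  by rewrite mulrC.
apply: (@le_trans _ _ ((\sum_(j < N) EOA (reduced_AB rho j)) `^ beta)).
  apply: ge0_ler_powR; rewrite ?nnegrE ?EOA_ge0 //; last exact: EOA_polygamy_sum.
  by apply: sumr_ge0 => j _; exact: EOA_ge0.
under eq_bigr do rewrite -xE; under [leRHS]eq_bigr do rewrite -xE.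
rewrite -(big_mkord xpredT x).
rewrite -(big_mkord xpredT (fun j =>
  (((1 + k) `^ beta - 1) / k `^ beta) ^+ hamming_weight j * x j `^ beta)).
(* [N] digits suffice, since [N < 2 ^ N]. *)
by apply: (powR_sum_le hbeta hk (n := N)) => //; exact/ltnW/ltn_expl.
Qed.
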